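(* Let $\mathcal{H}(x)=\sum_{n\leqslant x}2\uparrow\uparrow H(n)$. Then for $x\geqslant 2$, $$\mathcal{H}(x)=\frac{x\log^*x}{2}+c_1x+H_1(x)+O\!\left(x^{1/2}(\log x)^{9/4}\right),$$ where $c_1=\sum_{k=1}^{\infty}\left((2\uparrow\uparrow k)\mathcal{D}_k-\tfrac12\right)=1.813\ldots$ and $H_1(x)=(2\uparrow\uparrow \log^*x)\left(\mathcal{D}_{\log^*x}(x)-x\,\mathcal{D}_{\log^*x}\right)$. Moreover: (i) $H_1(x)\ll x$; (ii) $H_1(x)\ll x^{1/2}(\log x)^{9/4}$ if $x=(2\uparrow\uparrow N)-1$ for some natural $N$; (iii) $H_1(x)=x/2+O(x^{\Delta})$ with $\Delta=2-\frac{\log 3}{\log 2}=0.41503\ldots$, if $x=2\uparrow\uparrow N$ for some natural $N$.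
   Context: For a natural number $n$, $H(n)$ is the height of its factorization tree: $H(1)=0$ and, for $n=p_1^{\alpha_1}\cdots p_k^{\alpha_k}>1$ with distinct primes $p_i$, $H(n)=1+\max_i H(\alpha_i)$. Tetration: $a\uparrow\uparrow 0=1$, $a\uparrow\uparrow b=a^{a\uparrow\uparrow(b-1)}$ for $b\geqslant1$. For $x\geqslant 2$, $\log^*x$ is the integer $m\geqslant1$ with $2\uparrow\uparrow m\leqslant x<2\uparrow\uparrow(m+1)$. For $k\geqslant1$, $\mathcal{D}_k(x)=\#\{n\leqslant x:H(n)=k\}$ and $\mathcal{D}_k=\lim_{x\to\infty}\mathcal{D}_k(x)/x$ (the natural density of $\{n:H(n)=k\}$, which exists). *)

(* Defs.v *)
From Stdlib Require Import Reals.
From Coquelicot Require Import Coquelicot.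
From mathcomp Require Import ssreflect ssrfun ssrbool eqtype ssrnat seq prime.
Open Scope nat_scope.

(* Height of the factorization tree, with fuel.  For n > 1,
   H(n) = 1 + max_{p | n} H(v_p(n)); exponents v_p(n) < n, so fuel n suffices. *)
Fixpoint Hf (fuel n : nat) : nat :=
  match fuel with
  | 0 => 0
  | S f => if (n <= 1)%N then 0
           else S (foldr (fun p m => maxn (Hf f (logn p n)) m) 0 (primes n))
  end.
Definition H (n : nat) : nat := Hf n n.

Fixpoint tet (a b : nat) : nat :=
  match b with
  | 0 => 1
  | S b' => a ^ tet a b'
  end.

Definition nfloor (x : R) : nat := Z.to_nat (Int_part x).

(* log* on naturals: the largest m <= n with 2↑↑m <= n (0 if none).
   Since 2↑↑m > m, for n >= 2 this is the unique m >= 1 with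
   2↑↑m <= n < 2↑↑(m+1). *)
Fixpoint ls_aux (fuel n : nat) : nat :=
  match fuel with
  | 0 => 0
  | S f => if (tet 2 (S f) <= n)%N then S f else ls_aux f n
  end.
Definition logstar_nat (n : nat) : nat := ls_aux n n.
(* log* x for real x >= 2 (tetrations are integers, so only floor x matters). *)
Definition logstar (x : R) : nat := logstar_nat (nfloor x).

Definition DcountN (k N : nat) : nat := count (fun n => H n == k) (iota 1 N).
Definition Dcount (k : nat) (x : R) : R := INR (DcountN k (nfloor x)).

Definition Dens (k : nat) : R := real (Lim_seq (fun N => (INR (DcountN k N) / INR N)%R)).

Definition calH (x : R) : R :=
  foldr Rplus 0%R [seq INR (tet 2 (H n)) | n <- iota 1 (nfloor x)].

Definition c1_term (j : nat) : R := (INR (tet 2 j.+1) * Dens j.+1 - 1/2)%R.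
Definition c_1 : R := Series c1_term.

Definition H1 (x : R) : R :=
  (INR (tet 2 (logstar x)) * (Dcount (logstar x) x - x * Dens (logstar x)))%R.

Definition errE (x : R) : R := (Rpower x (1/2) * Rpower (ln x) (9/4))%R.

Definition Delta_exp : R := (2 - ln 3 / ln 2)%R.

(* Main.v *)
(* Write Q_k for the density of {H <= k}. Since H(n) <= k + 1
   is a condition on each exponent of n (allowing the exponents 0 and 1), its
   indicator is 1 * g with |g| at most the indicator of the squarefull numbers. As
   the latter number O(sqrt N), #{n <= N : H(n) <= k} = Q_k N + O(sqrt N) uniformly
   in k. The weights 2^^k with k < log* x add up to O(log x), so only k = log* x
   escapes the error term, and this is H_1.
   With m = 2^^k, {H > k} consists, up to density O(4^-m), of the n with v_2(n) = m
   or v_3(n) = m, so (2^^(k+1)) D_(k+1) = 1/2 + O((2/3)^m): this gives the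
   convergence of c_1 and (iii).
   The value of c_1 rests on Q_1 = 1/zeta(2), on a finite sieve for Q_2, and on the
   sharp form of the preceding estimate for k = 3. *)
Require Import Defs.
From HB Require Import structures.
From Stdlib Require Import Reals Lra.
From Coquelicot Require Import Coquelicot.
From mathcomp Require Import ssreflect ssrfun ssrbool eqtype ssrnat seq div fintype bigop prime.
Set Implicit Arguments.
Unset Strict Implicit.
Unset Printing Implicit Defensive.

Local Open Scope nat_scope.

(** * Factorization trees and tetration *)

(** Only {H <= k} is described exponent by exponent, so D_k is always handled as a difference of two
    such sets. The estimates must be uniform in k, since k = log* x grows with x; the constant in
    front of sqrt N is absolute because g takes only the values -1, 0, 1, whatever k is. The error
    obtained is O(x^(1/2) log x), and it is compared with [errE] only at the very end. The natural
    scale is m = 2^^j, where the weight 2^^(j+1) equals 2^m. The class v_2(n) = m has density 2^-m /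
    2, which is the 1/2 subtracted in [c1_term j]; the class v_3(n) = m then contributes
    (2/3)^(m+1), the true size of that term. Two facts about 2/3 finish the argument. As (2/3)^2 <
    1/2, for x < 2^m the product x (2/3)^m is at most sqrt x, which disposes of the tail of c_1. As
    2 (2/3) = 2^Delta, for x = 2^m the same product is exactly x^Delta, which is the error in
    (iii). *)

Lemma foldr_maxn (I : Type) (g : I -> nat) (s : seq I) :
  foldr (fun p m => maxn (g p) m) 0 s = \max_(p <- s) g p.
Proof. by elim: s => [|p s IHs] /=; rewrite ?big_nil // big_cons IHs. Qed.

Lemma Hf_fuel f1 f2 n : n <= f1 -> n <= f2 -> Hf f1 n = Hf f2 n.
Proof.
elim: f1 f2 n => [|f1 IHf] [|f2] n //=.
- by rewrite leqn0 => /eqP ->.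
- by rewrite leqn0 => _ /eqP ->.
case: (leqP n 1) => // n_gt1 le1 le2; rewrite !foldr_maxn; congr _.+1.
have lt_log p : logn p n < n by apply: ltn_logl; apply: ltnW.
by apply: eq_bigr => p _; apply: IHf; rewrite -ltnS; apply: leq_trans (lt_log p) _.
Qed.

Lemma HE n : 1 < n -> H n = (\max_(p <- primes n) H (logn p n)).+1.
Proof.
rewrite /H; case: n => //= n n_gt1; rewrite leqNgt n_gt1 /= foldr_maxn.
congr _.+1; apply: eq_bigr => p _; apply: Hf_fuel => //.
by rewrite -ltnS ltn_logl.
Qed.

Lemma H_leS n k : (H n <= k.+1) = all (fun p => H (logn p n) <= k) (primes n).
Proof.
case: n => [|[|n]] //; rewrite HE // ltnS.
apply/bigmax_leqP_seq/allP => [h p pn|h p pn _]; first exact: h.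
exact: h.
Qed.

Lemma H_leSP n k :
  reflect (forall p, prime p -> H (logn p n) <= k) (H n <= k.+1).
Proof.
rewrite H_leS; apply: (iffP allP) => h p; last first.
  by rewrite mem_primes => /and3P[p_pr _ _]; apply: h.
move=> p_pr; have [/h//|] := boolP (p \in primes n).
by rewrite -logn_gt0 lognE lt0n negbK -lognE => /eqP->.
Qed.

Lemma H_gt n k :
  k < H n -> exists p, [/\ prime p, 0 < logn p n & k <= H (logn p n)].
Proof.
case: k => [|k] h.
  have n_gt1 : 1 < n by case: n h => [|[]].
  exists (pdiv n); rewrite pdiv_prime // logn_gt0 mem_primes pdiv_prime //.
  by rewrite ltnW // pdiv_dvd.
move: h; rewrite ltnNge H_leS -has_predC => /hasP[p pn] /=; rewrite -ltnNge => h.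
exists p; rewrite logn_gt0 pn h; split => //.
by move: pn; rewrite mem_primes => /andP[].
Qed.

Lemma H_logn n k p : prime p -> k < H (logn p n) -> k.+1 < H n.
Proof.
move=> p_pr h; rewrite ltnNge; apply/negP => /H_leSP/(_ p p_pr).
by rewrite leqNgt h.
Qed.

Lemma tetS k : tet 2 k.+1 = 2 ^ tet 2 k.
Proof. by []. Qed.

Lemma tet_gt0 k : 0 < tet 2 k.
Proof. by case: k => //= k; rewrite expn_gt0. Qed.

Lemma tet_double k : 2 * tet 2 k <= tet 2 k.+1.
Proof.
rewrite tetS; case: (tet 2 k) (tet_gt0 k) => // t _.
by rewrite expnS leq_mul2l ltn_expl.
Qed.

Lemma tet_ltS k : tet 2 k < tet 2 k.+1.
Proof. by apply: leq_trans (tet_double k); rewrite ltn_Pmull // tet_gt0. Qed.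

Lemma tet_leq j k : j <= k -> tet 2 j <= tet 2 k.
Proof.
elim: k => [|k IHk]; first by rewrite leqn0 => /eqP->.
rewrite leq_eqVlt => /orP[/eqP->//|]; rewrite ltnS => /IHk/leq_trans; apply.
exact: ltnW (tet_ltS k).
Qed.

Lemma tet_addl j k : tet 2 j + k <= tet 2 (j + k).
Proof. by elim: k => [|k IHk]; rewrite ?addn0 // !addnS; apply: leq_ltn_trans IHk (tet_ltS _). Qed.

Lemma tet_ltn k : k < tet 2 k.
Proof. exact: leq_trans (tet_addl 0 k). Qed.

Lemma H_ge_pow j n : 0 < n -> j < H n ->
  exists p b, [/\ prime p, 0 < b, p ^ b %| n & j <= H b].
Proof.
move=> n_gt0 /H_gt[p [p_pr l_gt0 h]]; exists p, (logn p n).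
by rewrite pfactor_dvdn // leqnn.
Qed.

(** A prime power p^b dividing n with H(b) >= k - 1 has p >= 2 and, inductively, b >= 2^^(k-1). With
    [H_tet] this makes 2^^k the least positive integer of height k. *)
Lemma tet_leq_of_H k n : 0 < n -> k <= H n -> tet 2 k <= n.
Proof.
elim: k n => // k IHk n n_gt0 /(H_ge_pow n_gt0)[p [b [p_pr b_gt0 dv h]]].
apply: leq_trans (dvdn_leq n_gt0 dv); rewrite tetS.
apply: (@leq_trans (2 ^ b)); first by rewrite leq_exp2l // IHk.
by rewrite leq_exp2r // prime_gt1.
Qed.

Lemma H_ge_dvd j n : 0 < n -> j < H n ->
  exists2 p, prime p & p ^ tet 2 j %| n.
Proof.
move=> n_gt0 /(H_ge_pow n_gt0)[p [b [p_pr b_gt0 dv h]]]; exists p => //.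
by apply: dvdn_trans dv; apply: dvdn_exp2l; apply: tet_leq_of_H.
Qed.

Lemma H_pfactor p b : prime p -> 0 < b -> H (p ^ b) = (H b).+1.
Proof.
move=> p_pr b_gt0; rewrite HE.
  by rewrite primesX // primes_prime // big_seq1 pfactorK.
by apply: leq_trans (prime_gt1 p_pr) _; rewrite -{1}(expn1 p) leq_exp2l ?prime_gt1.
Qed.

Lemma H_tet k : H (tet 2 k) = k.
Proof. by elim: k => // k IHk; rewrite tetS H_pfactor ?tet_gt0 // IHk. Qed.

Lemma expn_lt_3_2 b : 2 <= b -> 2 * 2 ^ b <= 3 ^ b.
Proof.
case: b => [|[|b]] // _; elim: b => // b IHb.
by rewrite (expnS 3) (expnS 2 b.+2) mulnCA leq_mul.
Qed.

(** Some p^b divides a with b >= 2^^(j-1). If p = 2, then a is a multiple of 2^^j other than 2^^j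
    itself; if p >= 3, then 3^b >= 2 2^b because b >= 2, which is where 2 <= j enters (a = 3 refutes
    the case j = 1). The gap turns the second-order terms of [Htail_le_sharp] into squares. *)
Lemma H_ge_gap j a : 2 <= j -> 0 < a -> j <= H a -> a != tet 2 j ->
  2 * tet 2 j <= a.
Proof.
case: j => [|j] // j_ge a_gt0 /(H_ge_pow a_gt0)[p [b [p_pr b_gt0 dv h]]] neq.
have b_ge : tet 2 j <= b by apply: tet_leq_of_H.
have [p2|p_neq2] := eqVneq p 2.
  have : tet 2 j.+1 %| a by apply: dvdn_trans dv; rewrite p2 tetS dvdn_exp2l.
  move=> /dvdnP[[|[|c]] ac]; first by rewrite ac in a_gt0.
    by rewrite ac mul1n eqxx in neq.
  by rewrite ac leq_mul2r orbT.
have p_ge3 : 3 <= p by rewrite ltn_neqAle eq_sym p_neq2 prime_gt1.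
apply: leq_trans (dvdn_leq a_gt0 dv); rewrite tetS.
apply: (@leq_trans (2 * 2 ^ b)); first by rewrite leq_mul2l leq_exp2l // b_ge orbT.
apply: (@leq_trans (3 ^ b)); last by rewrite leq_exp2r.
apply: expn_lt_3_2; apply: leq_trans b_ge.
by apply: leq_ltn_trans (tet_ltn j).
Qed.

Lemma ls_auxP f n :
  let m := ls_aux f n in
  (m <= f) /\ (0 < m -> tet 2 m <= n) /\ (forall k, 0 < k <= f -> tet 2 k <= n -> k <= m).
Proof.
elim: f => [|f [IH1 [IH2 IH3]]] /=.
  by do ![split] => // k; case: k => // k.
case: (leqP (2 ^ tet 2 f) n) => h; first by do ![split] => // k /andP[].
split; first exact: leqW.
split => // k /andP[k_gt0]; rewrite leq_eqVlt => /orP[/eqP ->|].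
  by move=> h2; have := leq_ltn_trans h2 h; rewrite ltnn.
by rewrite ltnS => kf; apply: IH3; rewrite k_gt0.
Qed.

Lemma logstar_natP n : 2 <= n ->
  [/\ 0 < logstar_nat n, tet 2 (logstar_nat n) <= n
    & n < tet 2 (logstar_nat n).+1].
Proof.
move=> n_ge2; have [m_le [m_tet m_max]] := ls_auxP n n; rewrite /logstar_nat.
have m_gt0 : 0 < ls_aux n n by apply: (m_max 1) => //; apply: ltnW.
split => //; first exact: m_tet.
rewrite ltnNge; apply/negP => h.
have l_le : (ls_aux n n).+1 <= n by apply: leq_trans (ltnW (tet_ltn _)) h.
by have := m_max (ls_aux n n).+1 l_le h; rewrite ltnn.
Qed.

Lemma logstar_nat_uniq n m : 2 <= n -> tet 2 m <= n < tet 2 m.+1 -> logstar_nat n = m.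
Proof.
move=> n_ge2 /andP[h1 h2]; have [l_gt0 l1 l2] := logstar_natP n_ge2.
apply/eqP; rewrite eqn_leq; apply/andP; split; rewrite leqNgt; apply/negP => /tet_leq h.
  by have := leq_ltn_trans (leq_trans h l1) h2; rewrite ltnn.
by have := leq_ltn_trans (leq_trans h h1) l2; rewrite ltnn.
Qed.

Open Scope R_scope.

(** * Divisor convolution for conditions on exponents *)

HB.instance Definition _ := Monoid.isComLaw.Build R 0 Rplus
  (fun x y z => esym (Rplus_assoc x y z)) Rplus_comm Rplus_0_l.
HB.instance Definition _ := Monoid.isComLaw.Build R 1 Rmult
  (fun x y z => esym (Rmult_assoc x y z)) Rmult_comm Rmult_1_l.
HB.instance Definition _ := Monoid.isMulLaw.Build R 0 Rmult Rmult_0_l Rmult_0_r.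
HB.instance Definition _ := Monoid.isAddLaw.Build R Rmult Rplus
  (fun x y z => Rmult_plus_distr_r x y z) Rmult_plus_distr_l.

Local Notation "\sum_ ( i <- r | P ) F" := (\big[Rplus/0%R]_(i <- r | P%B) F%R) : R_scope.
Local Notation "\sum_ ( i <- r ) F" := (\big[Rplus/0%R]_(i <- r) F%R) : R_scope.
Local Notation "\sum_ ( m <= i < n | P ) F" :=
  (\big[Rplus/0%R]_(m <= i < n | P%B) F%R) : R_scope.
Local Notation "\sum_ ( m <= i < n ) F" := (\big[Rplus/0%R]_(m <= i < n) F%R) : R_scope.
Local Notation "\prod_ ( i <- r ) F" := (\big[Rmult/1%R]_(i <- r) F%R) : R_scope.

Lemma Rsum_le (I : eqType) (r : seq I) (P : pred I) (F G : I -> R) :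
  (forall i, i \in r -> P i -> F i <= G i) ->
  \sum_(i <- r | P i) F i <= \sum_(i <- r | P i) G i.
Proof.
move=> le_FG; rewrite big_seq_cond [X in _ <= X]big_seq_cond.
apply: (big_ind2 Rle) => [|x1 x2 y1 y2|i /andP[]]; [lra|exact: Rplus_le_compat|].
exact: le_FG.
Qed.

Lemma Rsum_nat_le m n (F G : nat -> R) :
  (forall i, (m <= i < n)%N -> F i <= G i) ->
  \sum_(m <= i < n) F i <= \sum_(m <= i < n) G i.
Proof. by move=> le_FG; apply: Rsum_le => i; rewrite mem_index_iota => /le_FG. Qed.

Lemma Rsum_ge0 (I : eqType) (r : seq I) (P : pred I) (F : I -> R) :
  (forall i, i \in r -> P i -> 0 <= F i) -> 0 <= \sum_(i <- r | P i) F i.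
Proof.
move=> F_ge0; rewrite big_seq_cond; apply: big_ind => [|x y|i /andP[]].
- lra.
- exact: Rplus_le_le_0_compat.
exact: F_ge0.
Qed.

Lemma Rsum_abs (I : Type) (r : seq I) (P : pred I) (F : I -> R) :
  Rabs (\sum_(i <- r | P i) F i) <= \sum_(i <- r | P i) Rabs (F i).
Proof.
apply: (big_ind2 (fun x y => Rabs x <= y)) => [|x1 x2 y1 y2 le1 le2|i _].
- rewrite Rabs_R0; lra.
- apply: Rle_trans (Rabs_triang _ _) _; lra.
lra.
Qed.

Lemma Rsum_opp (I : Type) (r : seq I) (P : pred I) (F : I -> R) :
  \sum_(i <- r | P i) (- F i) = - \sum_(i <- r | P i) F i.
Proof. by rewrite (big_morph Ropp Ropp_plus_distr Ropp_0). Qed.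

Lemma Rsum_minus (I : Type) (r : seq I) (P : pred I) (F G : I -> R) :
  \sum_(i <- r | P i) (F i - G i) =
  \sum_(i <- r | P i) F i - \sum_(i <- r | P i) G i.
Proof. by rewrite /Rminus -Rsum_opp -big_split. Qed.

Lemma Rsum_mulr (I : Type) (r : seq I) (P : pred I) (F : I -> R) c :
  \sum_(i <- r | P i) (c * F i) = c * \sum_(i <- r | P i) F i.
Proof. by rewrite big_distrr. Qed.

Definition b2R (b : bool) : R := if b then 1 else 0.

Lemma b2R_bounds b : 0 <= b2R b <= 1.
Proof. case: b => /=; lra. Qed.

Lemma b2R_and a b : b2R (a && b) = b2R a * b2R b.
Proof. case: a b => [] [] /=; lra. Qed.

Lemma INR_sum (I : Type) (r : seq I) (P : pred I) (F : I -> nat) :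
  INR (\sum_(i <- r | P i) F i)%N = \sum_(i <- r | P i) INR (F i).
Proof. exact: (big_morph INR plus_INR). Qed.

Definition count_upto (P : pred nat) (N : nat) : nat := count P (iota 1 N).

Lemma count_uptoE P N :
  INR (count_upto P N) = \sum_(1 <= n < N.+1) b2R (P n).
Proof.
rewrite /index_iota subSS subn0 /count_upto -sum1_count big_mkcond INR_sum.
by apply: eq_bigr => i _; case: (P i).
Qed.

Lemma count_upto_le P N : (count_upto P N <= N)%N.
Proof. by apply: leq_trans (count_size _ _) _; rewrite size_iota. Qed.

Section Convolution.
Variable A : pred nat.
Hypothesis A0 : A 0%N.

Definition exps_in (n : nat) : bool := all (fun p => A (logn p n)) (primes n).

(** The value at p^a, the same for every prime p, of the multiplicative g whose convolution with 1
    is the indicator of [exps_in]; g itself is [conv]. *)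
Definition jump (a : nat) : R :=
  if a is a'.+1 then b2R (A a) - b2R (A a') else b2R (A a).

Definition conv (n : nat) : R := \prod_(p <- primes n) jump (logn p n).

Lemma sum_jump v : \sum_(0 <= a < v.+1) jump a = b2R (A v).
Proof. by elim: v => [|v IHv]; rewrite ?big_nat1 // big_nat_recr //= IHv; lra. Qed.

(** Induction suited to multiplicative functions: the full power of the smallest prime factor is
    stripped off at each step. *)
Lemma coprime_part_ind (P : nat -> Prop) :
  P 1%N ->
  (forall p v m, prime p -> (0 < v)%N -> (0 < m)%N -> ~~ (p %| m)%N ->
     P m -> P (m * p ^ v)%N) ->
  forall n, (0 < n)%N -> P n.
Proof.
move=> P1 PM n; elim/ltn_ind: n => n IHn n_gt0.
have [n_le1|n_gt1] := leqP n 1.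
  by have -> : n = 1%N by apply/eqP; rewrite eqn_leq n_le1.
have p_pr := pdiv_prime n_gt1; have [m co_pm def_n] := pfactor_coprime p_pr n_gt0.
have v_gt0 : (0 < logn (pdiv n) n)%N.
  by rewrite logn_gt0 mem_primes p_pr n_gt0 pdiv_dvd.
have m_gt0 : (0 < m)%N by move: n_gt0; rewrite def_n muln_gt0 => /andP[].
rewrite def_n; apply: PM => //; first by rewrite -prime_coprime.
apply: IHn => //; rewrite def_n -[X in (X < _)%N]muln1 ltn_pmul2l //.
by rewrite -(expn0 (pdiv n)) ltn_exp2l // prime_gt1.
Qed.

Section CoprimePart.
Variables p v m : nat.
Hypotheses (p_pr : prime p) (v_gt0 : (0 < v)%N) (m_gt0 : (0 < m)%N).
Hypothesis pNm : ~~ (p %| m)%N.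

Lemma logn_part : logn p (m * p ^ v) = v.
Proof.
by rewrite lognM ?expn_gt0 ?(prime_gt0 p_pr) // pfactorK // lognE p_pr m_gt0 (negPf pNm).
Qed.

Lemma logn_part_neq q : q != p -> logn q (m * p ^ v) = logn q m.
Proof.
move=> qp; rewrite lognM ?expn_gt0 ?(prime_gt0 p_pr) // lognX (@logn_prime q p) //.
by rewrite (negPf qp) muln0 addn0.
Qed.

Lemma primes_part : perm_eq (primes (m * p ^ v)) (p :: primes m).
Proof.
apply: uniq_perm; first exact: primes_uniq.
  by rewrite /= primes_uniq mem_primes (negPf pNm) !andbF.
move=> q; rewrite primesM ?expn_gt0 ?(prime_gt0 p_pr) // primesX //.
by rewrite (primes_prime p_pr) !inE orbC.
Qed.

Lemma primes_part_neq q : q \in primes m -> q != p.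
Proof.
by rewrite mem_primes => /and3P[_ _ qm]; apply: contraNneq pNm => <-.
Qed.

Lemma exps_in_part : exps_in (m * p ^ v) = A v && exps_in m.
Proof.
rewrite /exps_in (perm_all _ primes_part) /= logn_part; congr andb.
by apply: eq_in_all => q qm; rewrite logn_part_neq ?primes_part_neq.
Qed.

Lemma conv_part : conv (m * p ^ v) = jump v * conv m.
Proof.
rewrite /conv (perm_big _ primes_part) big_cons logn_part; congr Rmult.
rewrite big_seq [RHS]big_seq; apply: eq_bigr => q qm.
by rewrite logn_part_neq ?primes_part_neq.
Qed.

(** The valuation at p recovers a, and then d, from d p^a, so the products on the right are pairwise
    distinct. *)
Lemma divisors_part :
  perm_eq (divisors (m * p ^ v))
          [seq (d * p ^ a)%N | a <- iota 0 v.+1, d <- divisors m].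
Proof.
have pv_gt0 k : (0 < p ^ k)%N by rewrite expn_gt0 prime_gt0.
have div_ndvd d : (d \in divisors m) -> ~~ (p %| d)%N /\ (0 < d)%N.
  rewrite -dvdn_divisors // => dm; rewrite (dvdn_gt0 m_gt0) //; split => //.
  by apply: contra pNm => /dvdn_trans; apply.
have log_d d a : d \in divisors m -> logn p (d * p ^ a) = a.
  move=> /div_ndvd[pNd d_gt0].
  by rewrite lognM // pfactorK // lognE p_pr d_gt0 (negPf pNd).
apply: uniq_perm; first exact: divisors_uniq.
  apply: allpairs_uniq => //; first exact: iota_uniq; first exact: divisors_uniq.
  move=> [a d] [a' d'] h1 h2 /= eq_dd.
  have d1 : d \in divisors m by case/allpairsP: h1 => -[? ?] [_ ? [_ ->]].
  have d2 : d' \in divisors m by case/allpairsP: h2 => -[? ?] [_ ? [_ ->]].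
  have eq_a := congr1 (logn p) eq_dd; rewrite !log_d // in eq_a.
  rewrite eq_a in eq_dd *; congr pair; apply/eqP.
  by rewrite -(eqn_pmul2r (pv_gt0 a')) -{1}eq_a eq_a eq_dd.
have mp_gt0 : (0 < m * p ^ v)%N by rewrite muln_gt0 m_gt0 pv_gt0.
move=> d; rewrite -dvdn_divisors //.
apply/idP/allpairsP => [dv|[[a e] [a_in e_in ->]]]; last first.
  have {}a_in : a \in iota 0 v.+1 := a_in; have {}e_in : e \in divisors m := e_in.
  rewrite -dvdn_divisors // in e_in; rewrite dvdn_mul // dvdn_exp2l //.
  by move: a_in; rewrite mem_iota add0n ltnS.
have d_gt0 : (0 < d)%N by apply: dvdn_gt0 dv.
have [e co_pe def_d] := pfactor_coprime p_pr d_gt0.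
exists (logn p d, e); split => //.
  rewrite mem_iota /= ltnS -[X in (_ <= X)%N]logn_part.
  exact: dvdn_leq_log.
rewrite [(_, _).2]/= -dvdn_divisors // -(@Gauss_dvdl _ _ (p ^ v)); last first.
  by rewrite coprime_sym coprimeXl.
by apply: dvdn_trans dv; rewrite [X in (_ %| X)%N]def_d dvdn_mulr.
Qed.

End CoprimePart.

(** Both sides are multiplicative, and at p^v the left side telescopes by [sum_jump]. *)
Lemma sum_conv_divisors n : (0 < n)%N ->
  \sum_(d <- divisors n) conv d = b2R (exps_in n).
Proof.
move: n; apply: coprime_part_ind => [|p v m p_pr v_gt0 m_gt0 pNm IHm].
  by rewrite (_ : divisors 1 = [:: 1%N]) // big_seq1 /conv big_nil.
rewrite (perm_big _ (divisors_part v p_pr m_gt0 pNm)) big_allpairs_dep.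
rewrite exps_in_part // b2R_and -IHm -sum_jump /index_iota subn0.
rewrite [RHS]big_distrl /=; apply: eq_bigr => a _.
rewrite -Rsum_mulr big_seq [RHS]big_seq; apply: eq_bigr => d.
rewrite -dvdn_divisors // => dm.
have d_gt0 := dvdn_gt0 m_gt0 dm.
have pNd : ~~ (p %| d)%N by apply: contra pNm => /dvdn_trans; apply.
(* [conv_part] concerns positive exponents; for a = 0 the extra factor is [jump A 0], equal to 1 by
   [A0]. *)
case: a => [|a]; last by rewrite conv_part.
by rewrite expn0 muln1 /= A0 Rmult_1_l.
Qed.

Lemma count_exps_in N :
  INR (count_upto exps_in N) = \sum_(1 <= d < N.+1) conv d * INR (N %/ d).
Proof.
rewrite count_uptoE.
transitivity (\sum_(1 <= n < N.+1) \sum_(1 <= d < N.+1) conv d * b2R (d %| n)%N).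
  rewrite big_nat [RHS]big_nat; apply: eq_bigr => n /andP[n_gt0 nN].
  rewrite -sum_conv_divisors //.
  have pe : perm_eq (divisors n) [seq d <- index_iota 1 N.+1 | (d %| n)%N].
    apply: uniq_perm; rewrite ?divisors_uniq ?filter_uniq ?iota_uniq // => d.
    rewrite mem_filter -dvdn_divisors // mem_index_iota.
    case dn: (d %| n)%N => //=; rewrite (dvdn_gt0 n_gt0 dn) /=.
    by rewrite (leq_ltn_trans (dvdn_leq n_gt0 dn)).
  rewrite (perm_big _ pe) big_filter big_mkcond; apply: eq_bigr => d _ /=.
  case: (d %| n)%N => /=; lra.
rewrite exchange_big /=; apply: eq_bigr => d _.
rewrite Rsum_mulr divn_count_dvd INR_sum; congr Rmult.
by apply: eq_bigr => i _; case: (d %| i)%N.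
Qed.

End Convolution.

(** * Counting with error O(sqrt N) *)

Lemma Rsum_nat1 (F : nat -> R) : \sum_(1 <= i < 1) F i = 0.
Proof. by rewrite big_geq. Qed.

Lemma Rsum_nat_recr (F : nat -> R) N :
  \sum_(1 <= i < N.+2) F i = \sum_(1 <= i < N.+1) F i + F N.+1.
Proof. by rewrite big_nat_recr. Qed.

Lemma INR_S_gt0 n : 0 < INR n.+1.
Proof. exact/lt_0_INR/leP. Qed.

Lemma leq_INR m n : (m <= n)%N -> INR m <= INR n.
Proof. by move/leP/le_INR. Qed.

Lemma INR_ge1 n : (0 < n)%N -> 1 <= INR n.
Proof. by move/leq_INR. Qed.

Definition squarefull (n : nat) : bool :=
  all (fun p => 1 < logn p n)%N (primes n).

Lemma squarefullE : squarefull =1 exps_in (fun a => 1 < a)%N.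
Proof. by []. Qed.

(** An exponent v >= 2 is 2i if even and 2i + 3 if odd: in the odd case one factor p goes to the
    cube and (v - 3)/2 of them to the square. *)
Lemma squarefull_sq_cube n : (0 < n)%N -> squarefull n ->
  exists a b, [/\ (0 < a)%N, (0 < b)%N & n = (a ^ 2 * b ^ 3)%N].
Proof.
move: n; apply: coprime_part_ind => [|p v m p_pr v_gt0 m_gt0 pNm IHm].
  by exists 1%N, 1%N.
rewrite squarefullE exps_in_part // => /andP[v_gt1 /IHm[a [b [a_gt0 b_gt0 ->]]]].
have p_gt0 := prime_gt0 p_pr.
case v_odd: (odd v); last first.
  exists (a * p ^ v./2)%N, b; rewrite muln_gt0 a_gt0 expn_gt0 p_gt0; split => //.
  by rewrite expnMn -expnM muln2 -[in LHS](odd_double_half v) v_odd add0n mulnAC.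
exists (a * p ^ (v - 3)./2)%N, (b * p)%N.
rewrite !muln_gt0 a_gt0 b_gt0 expn_gt0 p_gt0; split => //.
have v_ge3 : (3 <= v)%N by case: v v_gt1 v_odd {v_gt0} => [|[|[|]]].
have -> : (p ^ v = p ^ ((v - 3)./2 * 2) * p ^ 3)%N.
  rewrite -expnD muln2; congr expn.
  have := odd_double_half (v - 3); rewrite oddB // v_odd /= add0n => ->.
  by rewrite subnK.
by rewrite !expnMn -expnM mulnACA.
Qed.

(** At the largest n satisfying P, the count so far is at most n, hence at most y. *)
Lemma sum_indicator_le (P : pred nat) N y : 0 <= y ->
  (forall n, (0 < n)%N -> P n -> INR n <= y) ->
  \sum_(1 <= n < N.+1) b2R (P n) <= y.
Proof.
move=> y_ge0 Py; elim: N => [|N IHN]; first by rewrite Rsum_nat1.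
rewrite Rsum_nat_recr; case PN: (P N.+1) => /=; last by rewrite Rplus_0_r.
apply: Rle_trans (Py _ _ PN) => //; rewrite -count_uptoE S_INR.
by apply: Rplus_le_compat_r; apply: leq_INR; apply: count_upto_le.
Qed.

(** Meant for s = sqrt n and t = sqrt (n + 1): the square roots telescope through this form. *)
Lemma inv_sub_consecutive s t : 0 < s -> 0 < t -> t * t = s * s + 1 ->
  / s - / t = / (s * t * (s + t)).
Proof.
move=> s_gt0 t_gt0 t2s.
have -> : / s - / t = (t - s) / (s * t) by field; lra.
have -> : t - s = / (s + t) by field_simplify_eq; [nra|lra].
by field; lra.
Qed.

Lemma sqrt_div y : 0 < y -> sqrt y / y = / sqrt y.
Proof.
move=> y_gt0; have := sqrt_lt_R0 _ y_gt0.
have := sqrt_sqrt _ (Rlt_le _ _ y_gt0).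
move: (sqrt y) => s <- s_gt0; field; lra.
Qed.

Lemma div_sqrt y : 0 < y -> y / sqrt y = sqrt y.
Proof.
move=> y_gt0; have := sqrt_lt_R0 _ y_gt0.
have := sqrt_sqrt _ (Rlt_le _ _ y_gt0).
move: (sqrt y) => s <- s_gt0; field; lra.
Qed.

(** The majorant 3 - 2 / sqrt n plays the part of the integral of u^(-3/2); it equals the sum at n =
    1, and its increment 2 / (s t (s + t)) is at least 1 / t^3. *)
Lemma sum_sqrt_cube N :
  \sum_(1 <= b < N.+1) / (INR b * sqrt (INR b)) <= 3.
Proof.
suff h n : \sum_(1 <= b < n.+2) / (INR b * sqrt (INR b)) <= 3 - 2 / sqrt (INR n.+1).
  case: N => [|N]; first by rewrite Rsum_nat1; lra.
  apply: Rle_trans (h N) _.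
  suff : 0 < 2 / sqrt (INR N.+1) by lra.
  by apply: Rdiv_lt_0_compat; [lra | apply/sqrt_lt_R0/INR_S_gt0].
elim: n => [|n IHn].
  rewrite Rsum_nat_recr Rsum_nat1 /= sqrt_1; lra.
rewrite Rsum_nat_recr; move: IHn.
set S := \sum_(1 <= b < n.+2) _ => IHn.
have s_gt0 : 0 < sqrt (INR n.+1) by apply/sqrt_lt_R0/INR_S_gt0.
have t_gt0 : 0 < sqrt (INR n.+2) by apply/sqrt_lt_R0/INR_S_gt0.
have s2 := sqrt_sqrt (INR n.+1) (Rlt_le _ _ (INR_S_gt0 n)).
have t2 := sqrt_sqrt (INR n.+2) (Rlt_le _ _ (INR_S_gt0 n.+1)).
rewrite [INR n.+2]S_INR in t2 *; rewrite -[INR n.+1 + 1]S_INR in t2 *.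
set s := sqrt (INR n.+1) in s_gt0 s2 IHn *; set t := sqrt (INR n.+2) in t_gt0 t2 *.
have t2s : t * t = s * s + 1 by rewrite t2 s2 S_INR.
have le_st : s <= t by nra.
rewrite -t2.
suff : / (t * t * t) <= 2 / s - 2 / t by lra.
have -> : 2 / s - 2 / t = 2 / (s * t * (s + t)).
  by rewrite /Rdiv -Rmult_minus_distr_l inv_sub_consecutive.
have -> : / (t * t * t) = 2 / (2 * (t * t * t)) by field; lra.
apply: Rmult_le_compat_l; first lra.
apply: Rinv_le_contravar; first by repeat apply: Rmult_lt_0_compat; lra.
nra.
Qed.

Definition squarefull_count N := \sum_(1 <= n < N.+1) b2R (squarefull n).

(** Pairs (a, b) with a^2 b^3 <= N are counted instead, which can only overcount: for each b there
    are at most sqrt (N / b^3) values of a, and the sum of b^(-3/2) is at most 3. *)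
Lemma squarefull_count_le N : squarefull_count N <= 3 * sqrt (INR N).
Proof.
have h1 : squarefull_count N <= \sum_(1 <= n < N.+1) \sum_(1 <= b < N.+1)
    \sum_(1 <= a < N.+1) b2R (n == a ^ 2 * b ^ 3)%N.
  apply: Rsum_nat_le => n /andP[n_gt0 nN].
  have nonneg (r : seq nat) (F : nat -> bool) : 0 <= \sum_(i <- r) b2R (F i).
    by apply: Rsum_ge0 => i _ _; case: (b2R_bounds (F i)).
  case sq: (squarefull n); last first.
    by apply: Rsum_ge0 => b _ _; apply: nonneg.
  have [a [b [a_gt0 b_gt0 def_n]]] := squarefull_sq_cube n_gt0 sq.
  have a_le : (a < N.+1)%N.
    apply: leq_ltn_trans nN; rewrite def_n.
    by apply: leq_trans (leq_pmulr _ _); rewrite ?expn_gt0 ?b_gt0 // -{1}(expn1 a) leq_pexp2l.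
  have b_le : (b < N.+1)%N.
    apply: leq_ltn_trans nN; rewrite def_n.
    by apply: leq_trans (leq_pmull _ _); rewrite ?expn_gt0 ?a_gt0 // -{1}(expn1 b) leq_pexp2l.
  rewrite (bigD1_seq b) ?iota_uniq ?mem_index_iota ?b_gt0 //=.
  rewrite (bigD1_seq a) ?iota_uniq ?mem_index_iota ?a_gt0 //= -def_n eqxx /=.
  set X := \big[_/_]_(i <- _ | _) b2R _; set Y := \big[_/_]_(i <- _ | _) _.
  have X_ge0 : 0 <= X by apply: Rsum_ge0 => i _ _; case: (b2R_bounds (n == i ^ 2 * b ^ 3)%N).
  have Y_ge0 : 0 <= Y by apply: Rsum_ge0 => i _ _; apply: nonneg.
  lra.
apply: Rle_trans h1 _; rewrite exchange_big /=.
have N_ge0 := pos_INR N.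
apply: (@Rle_trans _ (\sum_(1 <= b < N.+1) sqrt (INR N) * / (INR b * sqrt (INR b)))); last first.
  rewrite Rsum_mulr Rmult_comm; apply: Rmult_le_compat_r (sum_sqrt_cube N).
  exact: sqrt_pos.
apply: Rsum_nat_le => b /andP[b_gt0 _]; rewrite exchange_big /=.
have b_pos : 0 < INR b by apply/lt_0_INR/ltP.
have sb_pos : 0 < sqrt (INR b) by apply: sqrt_lt_R0.
apply: (@Rle_trans _ (\sum_(1 <= a < N.+1) b2R (a ^ 2 * b ^ 3 <= N)%N)).
  apply: Rsum_nat_le => a /andP[a_gt0 _].
  have ab_gt0 : (0 < a ^ 2 * b ^ 3)%N by rewrite muln_gt0 !expn_gt0 a_gt0 b_gt0.
  case: leqP => h.
    rewrite (bigD1_seq (a ^ 2 * b ^ 3)%N) ?iota_uniq ?mem_index_iota ?ab_gt0 //= eqxx /=.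
    rewrite big1 => [|i /negPf ->] //=; lra.
  rewrite big_nat big1 /=; first lra.
  move=> i /andP[_ iN]; case: eqP => // def_i.
  by move: (leq_trans iN h); rewrite def_i ltnn.
apply: sum_indicator_le => [|a a_gt0 h].
  apply: Rmult_le_pos; first exact: sqrt_pos.
  by apply/Rlt_le/Rinv_0_lt_compat/Rmult_lt_0_compat.
have {}h : INR a ^ 2 * INR b ^ 3 <= INR N.
  have := leq_INR h; rewrite mult_INR /expn /= !mult_INR; nra.
apply: (Rmult_le_reg_r (INR b * sqrt (INR b))); first exact: Rmult_lt_0_compat.
rewrite Rmult_assoc Rinv_l ?Rmult_1_r; last by apply: Rgt_not_eq; apply: Rmult_lt_0_compat.
apply: Rle_trans (sqrt_le_1_alt _ _ h).
rewrite -[X in X <= _]sqrt_Rsqr; last by apply: Rmult_le_pos; [apply: pos_INR | apply: Rmult_le_pos; lra].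
apply: sqrt_le_1_alt; rewrite /Rsqr; have := sqrt_sqrt _ (Rlt_le _ _ b_pos).
set s := sqrt _ => s2; rewrite -s2; apply: Req_le; ring.
Qed.

Section Density.
Variable A : pred nat.
Hypotheses (A0 : A 0%N) (A1 : A 1%N).

Lemma conv_abs_le n : Rabs (conv A n) <= b2R (squarefull n).
Proof.
have jump_le a : (0 < a)%N -> Rabs (jump A a) <= b2R (1 < a)%N.
  case: a => [|[|a]] //= _; first by rewrite A0 A1 Rminus_diag Rabs_R0; lra.
  by apply: Rabs_le; case: (A _) (A _) => [] [] /=; lra.
rewrite /conv /squarefull.
have : forall p, p \in primes n -> (0 < logn p n)%N by move=> p; rewrite logn_gt0.
elim: (primes n) => [|p s IHs] h /=.
  by rewrite big_nil Rabs_R1; lra.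
rewrite big_cons Rabs_mult b2R_and; apply: Rmult_le_compat.
- exact: Rabs_pos.
- exact: Rabs_pos.
- by apply: jump_le; apply: h; rewrite mem_head.
by apply: IHs => q qs; apply: h; rewrite inE qs orbT.
Qed.

Definition conv_sum N := \sum_(1 <= d < N.+1) conv A d / INR d.

(** Replacing the integer part of N/d by N/d costs at most 1 for each squarefull d <= N, and nothing
    for the other d, where [conv] vanishes. *)
Lemma count_conv_sum N :
  Rabs (INR (count_upto (exps_in A) N) - INR N * conv_sum N) <= 3 * sqrt (INR N).
Proof.
rewrite count_exps_in // /conv_sum -Rsum_mulr -Rsum_minus.
apply: Rle_trans (Rsum_abs _ _ _) _; apply: Rle_trans (squarefull_count_le N).
apply: Rsum_nat_le => d /andP[d_gt0 _].
have d_pos : 0 < INR d by apply/lt_0_INR/ltP.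
have -> : conv A d * INR (N %/ d) - INR N * (conv A d / INR d) =
          conv A d * (INR (N %/ d) - INR N / INR d) by field; lra.
rewrite Rabs_mult -[X in _ <= X]Rmult_1_r.
apply: Rmult_le_compat; [exact: Rabs_pos | exact: Rabs_pos | exact: conv_abs_le |].
have eN : INR N / INR d = INR (N %/ d) + INR (N %% d) / INR d.
  by rewrite {1}(divn_eq N d) plus_INR mult_INR; field; lra.
have lt_mod : INR (N %% d) < INR d by apply/lt_INR/ltP; rewrite ltn_mod.
have r_le1 : INR (N %% d) / INR d <= 1.
  by apply/Rcomplements.Rle_div_l => //; lra.
have r_ge0 : 0 <= INR (N %% d) / INR d.
  by apply: Rcomplements.Rdiv_le_0_compat => //; apply: pos_INR.
by rewrite eN; apply: Rabs_le; lra.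
Qed.

Lemma conv_sum_tail N M : (0 < N)%N -> (N <= M)%N ->
  Rabs (conv_sum M - conv_sum N) <= 6 / sqrt (INR N).
Proof.
move=> N_gt0 le_NM.
pose S n := squarefull_count n.
(* Abel summation against [S] gives the first two terms on the right; the bound
   [S n <= 3 sqrt n] makes the whole right-hand side dominate each new summand. *)
have key k : Rabs (conv_sum (N + k) - conv_sum N) <=
   S (N + k)%N / INR (N + k) - S N / INR N + 6 / sqrt (INR N) - 6 / sqrt (INR (N + k)).
  elim: k => [|k IHk]; first by rewrite addn0 Rminus_diag Rabs_R0; lra.
  rewrite addnS; move: IHk; have : (0 < N + k)%N by rewrite addn_gt0 N_gt0.
  case: (N + k)%N => // m _ IHm.
  have -> : conv_sum m.+2 = conv_sum m.+1 + conv A m.+2 / INR m.+2.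
    exact: Rsum_nat_recr.
  have -> : S m.+2 = S m.+1 + b2R (squarefull m.+2) by exact: Rsum_nat_recr.
  have -> : conv_sum m.+1 + conv A m.+2 / INR m.+2 - conv_sum N =
            (conv_sum m.+1 - conv_sum N) + conv A m.+2 / INR m.+2 by lra.
  apply: Rle_trans (Rabs_triang _ _) _.
  have m1 := INR_S_gt0 m; have m2 := INR_S_gt0 m.+1.
  have : Rabs (conv A m.+2 / INR m.+2) <= b2R (squarefull m.+2) / INR m.+2.
    rewrite /Rdiv Rabs_mult (Rabs_pos_eq (/ _)); last exact/Rlt_le/Rinv_0_lt_compat.
    apply: Rmult_le_compat_r (conv_abs_le _); exact/Rlt_le/Rinv_0_lt_compat.
  have Sm : S m.+1 <= 3 * sqrt (INR m.+1) by apply: squarefull_count_le.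
  set g := b2R (squarefull m.+2); set c := Rabs (conv A _ / _) => le_c.
  suff : S m.+1 / INR m.+1 - S m.+1 / INR m.+2 <=
         6 / sqrt (INR m.+1) - 6 / sqrt (INR m.+2).
    move: IHm le_c; rewrite /Rdiv (Rmult_plus_distr_r (S m.+1)); lra.
  have s_gt0 : 0 < sqrt (INR m.+1) by apply/sqrt_lt_R0.
  have t_gt0 : 0 < sqrt (INR m.+2) by apply/sqrt_lt_R0.
  have s2 := sqrt_sqrt (INR m.+1) (Rlt_le _ _ m1).
  have t2 := sqrt_sqrt (INR m.+2) (Rlt_le _ _ m2).
  set s := sqrt (INR m.+1) in s_gt0 s2 Sm *; set t := sqrt (INR m.+2) in t_gt0 t2 *.
  have t2s : t * t = s * s + 1 by rewrite t2 s2 (S_INR m.+1).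
  have le_st : s <= t by nra.
  rewrite -s2 -t2.
  have -> : S m.+1 / (s * s) - S m.+1 / (t * t) = S m.+1 * (/ (s * s * (t * t))).
    rewrite t2s; field; split; nra.
  have -> : 6 / s - 6 / t = 6 / (s * t * (s + t)).
  by rewrite /Rdiv -Rmult_minus_distr_l inv_sub_consecutive.
  apply: (@Rle_trans _ (3 * s * / (s * s * (t * t)))).
    apply: Rmult_le_compat_r => //; apply/Rlt_le/Rinv_0_lt_compat.
    by repeat apply: Rmult_lt_0_compat.
  have -> : 3 * s * / (s * s * (t * t)) = 6 / (s * t * (2 * t)) by field; lra.
  apply: Rmult_le_compat_l; first lra.
  apply: Rinv_le_contravar; first by repeat apply: Rmult_lt_0_compat; lra.
  by apply: Rmult_le_compat_l; [nra | lra].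
have := key (M - N)%N; rewrite subnKC // => h; apply: Rle_trans h _.
have M_gt0 := leq_trans N_gt0 le_NM.
have posN : 0 < INR N by apply/lt_0_INR/ltP.
have posM : 0 < INR M by apply/lt_0_INR/ltP.
have sM : 0 < sqrt (INR M) by apply: sqrt_lt_R0.
have : 0 <= S N / INR N.
  apply: Rcomplements.Rdiv_le_0_compat => //; apply: Rsum_ge0 => i _ _.
  by case: (b2R_bounds (squarefull i)).
have : S M / INR M <= 3 / sqrt (INR M).
  apply: (@Rle_trans _ (3 * sqrt (INR M) / INR M)).
    by apply: Rmult_le_compat_r (squarefull_count_le M); apply/Rlt_le/Rinv_0_lt_compat.
  by rewrite /Rdiv Rmult_assoc -[_ * / INR M]/(_ / INR M) sqrt_div //; apply: Rle_refl.
have : 0 < 3 / sqrt (INR M) by apply: Rdiv_lt_0_compat; lra.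
lra.
Qed.

Lemma sqrt_INR_large e : 0 < e -> exists2 N, (0 < N)%N & 6 / sqrt (INR N) < e.
Proof.
move=> e_gt0; have [N hN] := nfloor_ex ((6 / e) ^ 2) (pow2_ge_0 _).
exists N.+1 => //; rewrite S_INR; set y := INR N + 1 in hN *.
have y_gt0 : 0 < y by have := pos_INR N; rewrite /y; lra.
have sy := sqrt_lt_R0 _ y_gt0.
apply/Rcomplements.Rlt_div_l => //.
have : 6 / e < sqrt y.
  rewrite -[X in X < _](sqrt_pow2 (6 / e)); last by apply/Rlt_le/Rdiv_lt_0_compat; lra.
  by apply: sqrt_lt_1_alt; split; [exact: pow2_ge_0 | case: hN].
by move/(Rmult_lt_compat_l e _ _ e_gt0); rewrite (_ : e * (6 / e) = 6); [lra | field; lra].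
Qed.

(** delta is the sum of the series of conv(d)/d, convergent by the Cauchy criterion. The constant 9
    = 3 + 6 adds the rounding error to N times the tail of the series; it is the same for every
    A. *)
Lemma exps_in_density : exists delta, forall N,
  Rabs (INR (count_upto (exps_in A) N) - delta * INR N) <= 9 * sqrt (INR N).
Proof.
have [delta hd] : ex_finite_lim_seq conv_sum.
  apply/ex_lim_seq_cauchy_corr => e.
  have e2 : 0 < e / 2 by case: e => e /=; lra.
  have [N N_gt0 hN] := sqrt_INR_large e2; exists N => n m /leP hn /leP hm.
  have := conv_sum_tail N_gt0 hn; have := conv_sum_tail N_gt0 hm.
  have -> : conv_sum n - conv_sum m = (conv_sum n - conv_sum N) - (conv_sum m - conv_sum N) by lra.
  move=> h1 h2; apply: Rle_lt_trans (Rabs_triang _ _) _; rewrite Rabs_Ropp; lra.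
exists delta => N; have [->|N_gt0] := posnP N.
  by rewrite /= sqrt_0 Rmult_0_r Rminus_0_r Rabs_R0; lra.
have posN : 0 < INR N by apply/lt_0_INR/ltP.
have sN : 0 < sqrt (INR N) by apply: sqrt_lt_R0.
have tail : Rabs (delta - conv_sum N) <= 6 / sqrt (INR N).
  have lim_abs : is_lim_seq (fun M => Rabs (conv_sum M - conv_sum N)) (Rabs (delta - conv_sum N)).
    apply: (is_lim_seq_abs _ (Rbar.Finite _)).
    apply: is_lim_seq_minus'; first exact: hd; exact: is_lim_seq_const.
  apply: (is_lim_seq_le_loc _ (fun=> 6 / sqrt (INR N)) (Rbar.Finite _) (Rbar.Finite _) _ lim_abs).
    by exists N => M /leP; apply: conv_sum_tail.
  exact: is_lim_seq_const.
have -> : INR (count_upto (exps_in A) N) - delta * INR N =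
  (INR (count_upto (exps_in A) N) - INR N * conv_sum N) - INR N * (delta - conv_sum N) by ring.
apply: Rle_trans (Rabs_triang _ _) _; rewrite Rabs_Ropp Rabs_mult (Rabs_pos_eq (INR N)); last exact: pos_INR.
have := count_conv_sum N.
have := Rmult_le_compat_l _ _ _ (Rlt_le _ _ posN) tail.
have -> : INR N * (6 / sqrt (INR N)) = 6 * sqrt (INR N).
  by rewrite -[in RHS]div_sqrt //; field; lra.
lra.
Qed.

End Density.

(** * Natural density *)

Lemma INR_expn a b : INR (a ^ b)%N = INR a ^ b.
Proof. by elim: b => // b IHb; rewrite expnS mult_INR IHb. Qed.

(** Relational, so that it carries the existence of the limit; [Dens] and [Hdens], which are values
    of [Lim_seq], are then identified by uniqueness. *)
Definition density (P : pred nat) (d : R) : Prop :=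
  is_lim_seq (fun N => INR (count_upto P N) / INR N) (Rbar.Finite d).

Lemma count_uptoS P N : count_upto P N.+1 = (count_upto P N + P N.+1)%N.
Proof. by rewrite /count_upto -[in LHS](addn1 N) iotaD count_cat /= addn0 add1n. Qed.

Lemma eq_count_upto P Q N :
  (forall n, (0 < n)%N -> P n = Q n) -> count_upto P N = count_upto Q N.
Proof. by move=> ePQ; elim: N => // N IHN; rewrite !count_uptoS IHN ePQ. Qed.

Lemma eq_density P Q d :
  (forall n, (0 < n)%N -> P n = Q n) -> density P d -> density Q d.
Proof.
move=> ePQ; apply: is_lim_seq_ext => N; congr (INR _ / _).
exact: eq_count_upto.
Qed.

Lemma eventually_gt0 (P : nat -> Prop) :
  (forall n, (0 < n)%N -> P n) -> eventually P.
Proof. by move=> hP; exists 1%N => n /leP; apply: hP. Qed.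

Lemma is_lim_seq_div_INR c : is_lim_seq (fun N => c / INR N) (Rbar.Finite 0).
Proof.
have := is_lim_seq_scal_l _ c _ (is_lim_seq_inv _ _ is_lim_seq_INR _).
by rewrite /= Rmult_0_r; apply.
Qed.

Lemma density_ub P d b c : density P d ->
  (forall N, (0 < N)%N -> INR (count_upto P N) <= b * INR N + c) -> d <= b.
Proof.
move=> hd hb; have hbc : is_lim_seq (fun N => b + c / INR N) (Rbar.Finite b).
  rewrite -{2}(Rplus_0_r b); apply: is_lim_seq_plus'; first exact: is_lim_seq_const.
  exact: is_lim_seq_div_INR.
apply: (is_lim_seq_le_loc _ _ (Rbar.Finite _) (Rbar.Finite _) _ hd hbc).
apply: eventually_gt0 => N N_gt0; have N_pos : 0 < INR N by apply/lt_0_INR/ltP.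
apply/Rcomplements.Rle_div_l => //.
by rewrite Rmult_plus_distr_r /Rdiv Rmult_assoc Rinv_l ?Rmult_1_r; [apply: hb | lra].
Qed.

Lemma density_lb P d b c : density P d ->
  (forall N, (0 < N)%N -> b * INR N - c <= INR (count_upto P N)) -> b <= d.
Proof.
move=> hd hb; have hbc : is_lim_seq (fun N => b - c / INR N) (Rbar.Finite b).
  rewrite -{2}(Rminus_0_r b); apply: is_lim_seq_minus'; first exact: is_lim_seq_const.
  exact: is_lim_seq_div_INR.
apply: (is_lim_seq_le_loc _ _ (Rbar.Finite _) (Rbar.Finite _) _ hbc hd).
apply: eventually_gt0 => N N_gt0; have N_pos : 0 < INR N by apply/lt_0_INR/ltP.
apply/Rcomplements.Rle_div_r => //.
by rewrite Rmult_minus_distr_r /Rdiv Rmult_assoc Rinv_l ?Rmult_1_r; [apply: hb | lra].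
Qed.

Lemma density_of_sqrt P d C :
  (forall N, Rabs (INR (count_upto P N) - d * INR N) <= C * sqrt (INR N)) ->
  density P d.
Proof.
move=> h; apply/is_lim_seq_spec => e.
have C_ge0 : 0 <= C.
  have h1 := h 1%N; rewrite [INR 1]/= sqrt_1 (Rmult_1_r C) in h1.
  exact: Rle_trans (Rabs_pos _) h1.
(* [sqrt_INR_large] controls 6 / sqrt N, whence the factor 6; C + 1 is positive even when C = 0. *)
have e' : 0 < 6 * e / (C + 1) by case: e => e /= ?; apply: Rdiv_lt_0_compat; lra.
have [N N_gt0 hN] := sqrt_INR_large e'; exists N => n /leP le_n.
have n_gt0 := leq_trans N_gt0 le_n.
have N_pos : 0 < INR N by apply/lt_0_INR/ltP.
have n_pos : 0 < INR n by apply/lt_0_INR/ltP.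
have -> : INR (count_upto P n) / INR n - d = (INR (count_upto P n) - d * INR n) / INR n.
  by field; lra.
rewrite /Rdiv Rabs_mult (Rabs_pos_eq (/ _)); last exact/Rlt_le/Rinv_0_lt_compat.
apply: (@Rle_lt_trans _ (C * sqrt (INR n) * / INR n)).
  by apply: Rmult_le_compat_r (h n); apply/Rlt_le/Rinv_0_lt_compat.
rewrite Rmult_assoc -[_ * / INR n]/(_ / INR n) sqrt_div //.
have le_s : / sqrt (INR n) <= / sqrt (INR N).
  by apply: Rinv_le_contravar; [apply: sqrt_lt_R0 | apply/sqrt_le_1_alt/leq_INR].
have sn_pos : 0 < / sqrt (INR n) by apply/Rinv_0_lt_compat/sqrt_lt_R0.
have s_pos : 0 < / sqrt (INR N) by apply/Rinv_0_lt_compat/sqrt_lt_R0.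
apply: (@Rle_lt_trans _ ((C + 1) * / sqrt (INR N))); first by apply: Rmult_le_compat; lra.
have := Rmult_lt_compat_l (C + 1) _ _ _ hN.
have -> : (C + 1) * (6 * e / (C + 1)) = 6 * e by field; lra.
rewrite /Rdiv; nra.
Qed.

Lemma count_upto_lin_le P Q1 Q2 N :
  (forall n, (0 < n)%N -> b2R (P n) <= b2R (Q1 n) + b2R (Q2 n)) ->
  INR (count_upto P N) <= INR (count_upto Q1 N) + INR (count_upto Q2 N).
Proof.
move=> h; rewrite !count_uptoE -big_split /=.
by apply: Rsum_nat_le => n /andP[/h].
Qed.

Lemma density_le_add P Q1 Q2 p q1 q2 :
  (forall n, (0 < n)%N -> b2R (P n) <= b2R (Q1 n) + b2R (Q2 n)) ->
  density P p -> density Q1 q1 -> density Q2 q2 -> p <= q1 + q2.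
Proof.
move=> h hp h1 h2.
apply: (is_lim_seq_le_loc _ _ (Rbar.Finite _) (Rbar.Finite _) _ hp (is_lim_seq_plus' _ _ _ _ h1 h2)).
apply: eventually_gt0 => N N_gt0; rewrite -Rdiv_plus_distr.
apply: Rmult_le_compat_r; last exact: count_upto_lin_le.
by apply/Rlt_le/Rinv_0_lt_compat/lt_0_INR/ltP.
Qed.

Lemma density_le (P Q : pred nat) p q :
  (forall n, (0 < n)%N -> P n -> Q n) -> density P p -> density Q q -> p <= q.
Proof.
move=> h hp hq; have h0 : density pred0 0.
  apply: (is_lim_seq_ext (fun=> 0)); last exact: is_lim_seq_const.
  by move=> n; rewrite /count_upto count_pred0 /= /Rdiv Rmult_0_l.
rewrite -(Rplus_0_r q); apply: density_le_add hp hq h0 => n n_gt0.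
by have := h n n_gt0; case: (P n) (Q n) => [] [] /= himp; rewrite ?Rplus_0_r; try lra; have := himp isT.
Qed.

Lemma density_diff P Q1 Q2 p q1 :
  (forall n, (0 < n)%N -> b2R (Q2 n) = b2R (P n) - b2R (Q1 n)) ->
  density P p -> density Q1 q1 -> density Q2 (p - q1).
Proof.
move=> h hp h1.
apply: (is_lim_seq_ext (fun N => INR (count_upto P N) / INR N - INR (count_upto Q1 N) / INR N)).
  move=> N; rewrite /Rdiv -Rmult_minus_distr_r; congr (_ * _).
  rewrite !count_uptoE -Rsum_minus big_nat [RHS]big_nat.
  by apply: eq_bigr => n /andP[/h].
exact: is_lim_seq_minus'.
Qed.

Lemma density_true : density predT 1.
Proof.
apply: (is_lim_seq_ext_loc (fun=> 1)); last exact: is_lim_seq_const.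
apply: eventually_gt0 => N N_gt0; rewrite /count_upto count_predT size_iota.
by rewrite /Rdiv Rinv_r //; apply/not_0_INR; case: N N_gt0.
Qed.

Lemma count_upto_multiples P q N : (0 < q)%N ->
  count_upto (fun n => (q %| n)%N && P (n %/ q)%N) N = count_upto P (N %/ q).
Proof.
move=> q_gt0; elim: N => [|N IHN]; first by rewrite div0n.
rewrite count_uptoS IHN divnS //; case: (q %| N.+1)%N => /=; last by rewrite addn0.
by rewrite add1n count_uptoS.
Qed.

Lemma divn_bounds N q : (0 < q)%N ->
  INR N / INR q - 1 <= INR (N %/ q) <= INR N / INR q.
Proof.
move=> q_gt0; have q_pos : 0 < INR q by apply/lt_0_INR/ltP.
have eN : INR N / INR q = INR (N %/ q) + INR (N %% q) / INR q.
  by rewrite {1}(divn_eq N q) plus_INR mult_INR; field; lra.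
have lt_mod : INR (N %% q) < INR q by apply/lt_INR/ltP; rewrite ltn_mod.
have r_le1 : INR (N %% q) / INR q <= 1 by apply/Rcomplements.Rle_div_l => //; lra.
have r_ge0 : 0 <= INR (N %% q) / INR q.
  by apply: Rcomplements.Rdiv_le_0_compat => //; apply: pos_INR.
lra.
Qed.

Lemma density_multiples P q d : (0 < q)%N -> density P d ->
  density (fun n => (q %| n)%N && P (n %/ q)%N) (d / INR q).
Proof.
move=> q_gt0 hd; have q_pos : 0 < INR q by apply/lt_0_INR/ltP.
apply: (is_lim_seq_ext (fun N => INR (count_upto P (N %/ q)) / INR (N %/ q) * (INR (N %/ q) / INR N))).
  move=> N; rewrite count_upto_multiples //.
  have [->|Nq_gt0] := posnP (N %/ q); first by rewrite /= /Rdiv !(Rmult_0_l, Rmult_0_r).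
  have : 0 < INR (N %/ q) by apply/lt_0_INR/ltP.
  rewrite /Rdiv => ?; rewrite Rmult_assoc -(Rmult_assoc (/ _)) Rinv_l ?Rmult_1_l //; lra.
apply: is_lim_seq_mult'.
  apply: (is_lim_seq_subseq (fun n => INR (count_upto P n) / INR n) (Rbar.Finite d) (fun N => N %/ q)%N _ hd).
  move=> Z [K hK]; exists (K * q)%N => N /leP h.
  by apply: hK; apply/leP; rewrite leq_divRL.
have up : is_lim_seq (fun N => / INR q - 1 / INR N) (Rbar.Finite (/ INR q)).
  rewrite -{2}(Rminus_0_r (/ INR q)); apply: is_lim_seq_minus'; first exact: is_lim_seq_const.
  exact: is_lim_seq_div_INR.
apply: (is_lim_seq_le_le_loc _ _ _ _ _ up (is_lim_seq_const _)).
apply: eventually_gt0 => N N_gt0; have N_pos : 0 < INR N by apply/lt_0_INR/ltP.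
have [lo hi] := divn_bounds N q_gt0; split.
  apply/Rcomplements.Rle_div_r => //; apply: Rle_trans lo; apply: Req_le; field; lra.
by apply/Rcomplements.Rle_div_l => //; apply: Rle_trans hi _; apply: Req_le; field; lra.
Qed.

(** * Densities of the height sets *)

Definition Hdens (k : nat) : R :=
  real (Lim_seq (fun N => INR (count_upto (fun n => H n <= k)%N N) / INR N)).

Definition Htail (k : nat) : R := 1 - Hdens k.

Lemma H_le_count k N :
  Rabs (INR (count_upto (fun n => H n <= k)%N N) - Hdens k * INR N) <= 9 * sqrt (INR N).
Proof.
suff [q hq] : exists q, forall N,
    Rabs (INR (count_upto (fun n => H n <= k)%N N) - q * INR N) <= 9 * sqrt (INR N).
  suff -> : Hdens k = q by apply: hq.
  by rewrite /Hdens (is_lim_seq_unique _ _ (density_of_sqrt hq)).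
(* Height 0 forbids the exponent 1, so the convolution bound does not cover k = 0; that set has 1 as
   its only positive element, and density 0. *)
case: k => [|k]; last first.
  have [q hq] := @exps_in_density (fun a => H a <= k)%N isT isT.
  exists q => M; rewrite (@eq_count_upto _ (exps_in (fun a => H a <= k)%N)) // => n _.
  exact: H_leS.
exists 0 => -[|M]; first by rewrite /= sqrt_0 Rmult_0_l Rminus_0_r Rabs_R0; lra.
have s1 : 1 <= sqrt (INR M.+1).
  by rewrite -sqrt_1; apply/sqrt_le_1_alt/INR_ge1.
have le1 : INR (count_upto (fun n => H n <= 0)%N M.+1) <= 1.
  rewrite count_uptoE; apply: sum_indicator_le; first lra.
  move=> n n_gt0 hn; rewrite -[1]/(INR 1); apply: leq_INR.
  by rewrite leqNgt; apply/negP => n_gt1; rewrite HE in hn.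
rewrite Rmult_0_l Rminus_0_r Rabs_pos_eq; [lra | exact: pos_INR].
Qed.

Lemma density_H_le k : density (fun n => H n <= k)%N (Hdens k).
Proof. exact: density_of_sqrt (H_le_count k). Qed.

Lemma density_H_gt k : density (fun n => k < H n)%N (Htail k).
Proof.
apply: (density_diff _ density_true (@density_H_le k)) => n _ /=.
by rewrite ltnNge; case: (H n <= k)%N => /=; lra.
Qed.

Lemma density_H_eq k : density (fun n => H n == k.+1)%N (Htail k - Htail k.+1).
Proof.
apply: (density_diff _ (@density_H_gt k) (@density_H_gt k.+1)) => n _.
by case: (ltngtP (H n) k.+1) => _ /=; lra.
Qed.

Lemma DensE k : Dens k.+1 = Htail k - Htail k.+1.
Proof. by rewrite /Dens (is_lim_seq_unique _ _ (@density_H_eq k)). Qed.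

Lemma DcountN_diff k N : INR (DcountN k.+1 N) =
  INR (count_upto (fun n => H n <= k.+1)%N N) - INR (count_upto (fun n => H n <= k)%N N).
Proof.
rewrite [DcountN _ _]/(count_upto (fun n => H n == k.+1)%N N) !count_uptoE -Rsum_minus.
by apply: eq_bigr => n _; rewrite -(ltnS _ k); case: (ltngtP (H n) k.+1) => _ /=; lra.
Qed.

Lemma DcountN_bound k N :
  Rabs (INR (DcountN k.+1 N) - Dens k.+1 * INR N) <= 18 * sqrt (INR N).
Proof.
rewrite DensE /Htail DcountN_diff.
set a := INR _; set b := INR (count_upto _ N).
have -> : a - b - (1 - Hdens k - (1 - Hdens k.+1)) * INR N =
  (a - Hdens k.+1 * INR N) - (b - Hdens k * INR N) by ring.
apply: Rle_trans (Rabs_triang _ _) _; rewrite Rabs_Ropp.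
have := H_le_count k N; have := H_le_count k.+1 N; rewrite -/a -/b; lra.
Qed.

(** A bound up to a bounded error adds up over unions and does not presuppose a density, which suits
    covers such as [large_pow]. *)
Definition count_le (P : pred nat) b :=
  exists c, forall N, INR (count_upto P N) <= b * INR N + c.
Definition count_ge (P : pred nat) b :=
  exists c, forall N, b * INR N - c <= INR (count_upto P N).

Lemma density_count_le P d b : density P d -> count_le P b -> d <= b.
Proof. by move=> hd [c hc]; apply: density_ub hd _ => N _; apply: hc. Qed.

Lemma density_count_ge P d b : density P d -> count_ge P b -> b <= d.
Proof. by move=> hd [c hc]; apply: density_lb hd _ => N _; apply: hc. Qed.

Lemma count_le_or (P Q1 Q2 : pred nat) b1 b2 :
  (forall n, (0 < n)%N -> P n -> Q1 n || Q2 n) ->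
  count_le Q1 b1 -> count_le Q2 b2 -> count_le P (b1 + b2).
Proof.
move=> h [c1 h1] [c2 h2]; exists (c1 + c2) => N.
have : INR (count_upto P N) <= INR (count_upto Q1 N) + INR (count_upto Q2 N).
  apply: count_upto_lin_le => n n_gt0; have := h n n_gt0.
  by case: (P n) (Q1 n) (Q2 n) => [] [] [] /= himp; try lra; have := himp isT.
by have := h1 N; have := h2 N; lra.
Qed.

Lemma count_le_orb (Q1 Q2 : pred nat) b1 b2 :
  count_le Q1 b1 -> count_le Q2 b2 -> count_le (fun n => Q1 n || Q2 n) (b1 + b2).
Proof. exact: count_le_or. Qed.

Lemma count_dvd q N : (0 < q)%N ->
  INR N / INR q - 1 <= INR (count_upto (dvdn q) N) <= INR N / INR q.
Proof.
move=> q_gt0; have -> : count_upto (dvdn q) N = (N %/ q)%N.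
  rewrite (@eq_count_upto _ (fun n => (q %| n)%N && predT (n %/ q)%N)) => [|n _].
    by rewrite count_upto_multiples // /count_upto count_predT size_iota.
  by rewrite andbT.
exact: divn_bounds.
Qed.

Lemma count_le_dvd q : (0 < q)%N -> count_le (dvdn q) (/ INR q).
Proof.
by move=> q_gt0; exists 0 => N; have [_] := count_dvd N q_gt0; rewrite /Rdiv; lra.
Qed.

Lemma b2R_logn p a n : prime p -> (0 < n)%N ->
  b2R (logn p n == a) = b2R (p ^ a %| n)%N - b2R (p ^ a.+1 %| n)%N.
Proof.
move=> p_pr n_gt0; rewrite !pfactor_dvdn //.
by case: ltngtP => /=; lra.
Qed.

Lemma count_logn p a N : prime p ->
  Rabs (INR (count_upto (fun n => logn p n == a) N) -
        INR N * (/ INR p ^ a - / INR p ^ a.+1)) <= 1.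
Proof.
move=> p_pr.
have -> : INR (count_upto (fun n => logn p n == a) N) =
    INR (count_upto (dvdn (p ^ a)) N) - INR (count_upto (dvdn (p ^ a.+1)) N).
  rewrite !count_uptoE -Rsum_minus big_nat [RHS]big_nat.
  by apply: eq_bigr => n /andP[n_gt0 _]; apply: b2R_logn.
have pk_gt0 k : (0 < p ^ k)%N by rewrite expn_gt0 prime_gt0.
have := count_dvd N (pk_gt0 a); have := count_dvd N (pk_gt0 a.+1).
by rewrite !INR_expn /Rdiv => ? ?; apply: Rabs_le; lra.
Qed.

Lemma count_le_logn p a : prime p ->
  count_le (fun n => logn p n == a) (/ INR p ^ a - / INR p ^ a.+1).
Proof.
by move=> p_pr; exists 1 => N; have /Rabs_le_between := count_logn a N p_pr; lra.
Qed.

Lemma Rsum_recr m n (F : nat -> R) : (m <= n)%N ->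
  \sum_(m <= i < n.+1) F i = \sum_(m <= i < n) F i + F n.
Proof. exact: big_nat_recr. Qed.

(** Integral comparison made discrete: (x + 1)^-(m+1) is at most (x^-m - (x + 1)^-m) / m. After
    clearing denominators this is the Bernoulli-type inequality [bern]. *)
Lemma sum_inv_pow a m N : (0 < a)%N -> (0 < m)%N ->
  \sum_(a.+1 <= p < N.+1) / INR p ^ m.+1 <= / (INR m * INR a ^ m).
Proof.
move=> a_gt0 m_gt0; have a_pos : 0 < INR a by apply/lt_0_INR/ltP.
have m_pos : 0 < INR m by apply/lt_0_INR/ltP.
have am_pos := pow_lt _ m a_pos.
have bern x k : 0 <= x -> x ^ k * (INR k + (x + 1)) <= (x + 1) ^ k.+1.
  move=> x_ge0; elim: k => [|k IHk]; first by rewrite /=; lra.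
  have := Rmult_le_compat_l _ _ _ x_ge0 IHk.
  have : x ^ k.+1 <= (x + 1) ^ k.+1 by apply: pow_incr; lra.
  rewrite S_INR -!tech_pow_Rmult; set u := x ^ k; set v := (x + 1) ^ k; nra.
have [le_Na|lt_aN] := leqP N a.
  by rewrite big_geq //; apply/Rlt_le/Rinv_0_lt_compat/Rmult_lt_0_compat.
suff h k : \sum_(a.+1 <= p < (a + k).+1) / INR p ^ m.+1 <=
           / INR m * (/ INR a ^ m - / INR (a + k) ^ m).
  have := h (N - a)%N; rewrite subnKC ?(ltnW lt_aN) // => hN; apply: Rle_trans hN _.
  rewrite Rinv_mult; apply: Rmult_le_compat_l; first exact/Rlt_le/Rinv_0_lt_compat.
  have : 0 < / INR N ^ m by apply/Rinv_0_lt_compat/pow_lt/lt_0_INR/ltP/(leq_ltn_trans _ lt_aN).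
  lra.
elim: k => [|k IHk]; first by rewrite addn0 big_geq // Rminus_diag Rmult_0_r; lra.
rewrite addnS Rsum_recr; last by rewrite ltnS leq_addr.
move: IHk; set S := \big[_/_]_(_ <= _ < _) _ => IHk.
have x_pos : 0 < INR (a + k) by apply/lt_0_INR/ltP; rewrite addn_gt0 a_gt0.
have := bern _ m (Rlt_le _ _ x_pos).
rewrite -S_INR -[(a + k).+1]addnS.
have : 0 < INR (a + k.+1) by apply/lt_0_INR/ltP; rewrite addn_gt0 a_gt0.
move: (INR (a + k.+1)) => y y_pos.
move: (INR (a + k)) x_pos IHk => x x_pos IHk hb.
have xm := pow_lt _ m x_pos; have ym := pow_lt _ m y_pos.
rewrite -!tech_pow_Rmult in hb *.
suff : / (y * y ^ m) <= / INR m * (/ x ^ m - / y ^ m) by lra.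
apply: (Rmult_le_reg_r (y * y ^ m * x ^ m * INR m)); first by repeat apply: Rmult_lt_0_compat.
have -> : / (y * y ^ m) * (y * y ^ m * x ^ m * INR m) = x ^ m * INR m by field; lra.
have -> : / INR m * (/ x ^ m - / y ^ m) * (y * y ^ m * x ^ m * INR m) = y * y ^ m - y * x ^ m by field; lra.
lra.
Qed.

(** All integers p >= a are allowed, since the set only serves as a cover estimated by a union
    bound. The range stops at n because p^m | n forces p <= n when m and n are positive. *)
Definition large_pow a m (n : nat) : bool :=
  has (fun p => p ^ m %| n)%N (index_iota a n.+1).

Lemma large_powI a m n p : (0 < m)%N -> (0 < n)%N -> (a <= p)%N ->
  (p ^ m %| n)%N -> large_pow a m n.
Proof.
move=> m_gt0 n_gt0 ap pn; apply/hasP; exists p => //.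
rewrite mem_index_iota ap ltnS; case: p {ap} pn => // p pn.
by apply: leq_trans (dvdn_leq n_gt0 pn); rewrite -{1}(expn1 p.+1) leq_pexp2l.
Qed.

Lemma count_large_pow a m N : (0 < a)%N -> (0 < m)%N ->
  INR (count_upto (large_pow a.+1 m.+1) N) <= / (INR m * INR a ^ m) * INR N.
Proof.
move=> a_gt0 m_gt0; rewrite Rmult_comm.
apply: Rle_trans (Rmult_le_compat_l _ _ _ (pos_INR N) (sum_inv_pow N a_gt0 m_gt0)).
rewrite count_uptoE -Rsum_mulr.
apply: (@Rle_trans _ (\sum_(1 <= n < N.+1) \sum_(a.+1 <= p < N.+1) b2R (p ^ m.+1 %| n)%N)).
  apply: Rsum_nat_le => n /andP[n_gt0 nN].
  have nonneg (r : seq nat) (P : pred nat) : 0 <= \sum_(p <- r | P p) b2R (p ^ m.+1 %| n)%N.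
    by apply: Rsum_ge0 => i _ _; case: (b2R_bounds (i ^ m.+1 %| n)%N).
  case hl: (large_pow _ _ _); last exact: nonneg.
  have /hasP[p] := hl; rewrite mem_index_iota => /andP[ap pn] pdvd.
  have p_in : p \in index_iota a.+1 N.+1 by rewrite mem_index_iota ap (leq_trans pn).
  rewrite (bigD1_seq p) ?iota_uniq //= pdvd /=; have := nonneg (index_iota a.+1 N.+1) (fun i => i != p).
  lra.
rewrite exchange_big /=; apply: Rsum_nat_le => p /andP[ap _].
have p_gt0 : (0 < p ^ m.+1)%N by rewrite expn_gt0 (leq_trans _ ap).
have [_] := count_dvd N p_gt0.
by rewrite -count_uptoE INR_expn.
Qed.

Lemma count_le_large_pow a m : (0 < a)%N -> (0 < m)%N ->
  count_le (large_pow a.+1 m.+1) (/ (INR m * INR a ^ m)).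
Proof. by move=> a_gt0 m_gt0; exists 0 => N; rewrite Rplus_0_r; apply: count_large_pow. Qed.

(** With m = 2^^j, such an n is divisible by some p^m: p = 2 accounts for 2^-m and all p >= 3
    together for 1 / ((m - 1) 2^(m-1)) <= 2 2^-m. No additive constant appears, so the bound applies
    to actual counts as well as to densities. *)
Lemma count_H_gt j N : (0 < j)%N ->
  INR (count_upto (fun n => j < H n)%N N) <= 3 * / 2 ^ tet 2 j * INR N.
Proof.
move=> j_gt0; have := tet_leq j_gt0; rewrite [tet 2 1]/=.
case em: (tet 2 j) => [|[|m]] // _.
have le : INR (count_upto (fun n => j < H n)%N N) <=
    INR (count_upto (dvdn (2 ^ m.+2)) N) + INR (count_upto (large_pow 3 m.+2) N).
  apply: count_upto_lin_le => n n_gt0.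
  case hj: (j < H n)%N => /=; last by have := b2R_bounds (2 ^ m.+2 %| n)%N; have := b2R_bounds (large_pow 3 m.+2 n); lra.
  have [p p_pr pn] := H_ge_dvd n_gt0 hj; rewrite em in pn.
  have [p2|p_neq2] := eqVneq p 2%N.
    by rewrite p2 in pn; rewrite pn /=; have := b2R_bounds (large_pow 3 m.+2 n); lra.
  rewrite (large_powI _ _ _ pn) //=; last by rewrite ltn_neqAle eq_sym p_neq2 prime_gt1.
  by have := b2R_bounds (2 ^ m.+2 %| n)%N; lra.
have [_ h1] := @count_dvd (2 ^ m.+2) N (expn_gt0 2 _).
have h2 := @count_large_pow 2 m.+1 N isT isT.
rewrite INR_expn in h1.
have m1 : 1 <= INR m.+1 by apply: INR_ge1.
have p2 := pow_lt 2 m.+1 Rlt_0_2.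
have : / (INR m.+1 * INR 2 ^ m.+1) <= / 2 ^ m.+1.
  by apply: Rinv_le_contravar => //; rewrite -[INR 2]/2; nra.
have e : / 2 ^ m.+2 = / 2 * / 2 ^ m.+1 by rewrite -tech_pow_Rmult Rinv_mult.
rewrite -[INR 2]/2 in h1 h2 *.
move: h1 h2; rewrite /Rdiv e; set u := / 2 ^ m.+1; set w := / (_ * _).
have := pos_INR N; nra.
Qed.

Lemma Htail_ge0 j : 0 <= Htail j.
Proof.
apply: (density_count_ge (@density_H_gt j)); exists 0 => N.
by rewrite Rmult_0_l Rminus_0_r; apply: pos_INR.
Qed.

Lemma Htail_le j : (0 < j)%N -> Htail j <= 3 * / 2 ^ tet 2 j.
Proof.
move=> j_gt0; apply: (density_count_le (@density_H_gt j)); exists 0 => N.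
by rewrite Rplus_0_r; apply: count_H_gt.
Qed.

(** * The terms of the series c_1 *)

(** Inclusion-exclusion for v_2(n) = m and v_3(n) = m, whose common elements are multiples of 6^m.
    The slack 2 in the count is one rounding unit for each class. *)
Lemma Htail_ge j : (0 < j)%N -> let m := tet 2 j in
  / 2 ^ m * (/ 2) + / 3 ^ m * (2 / 3) - / 2 ^ m * / 3 ^ m <= Htail j.
Proof.
move=> j_gt0 m; apply: (density_count_ge (@density_H_gt j)); exists 2 => N.
have logn_H p n : prime p -> (logn p n == m) -> (j < H n)%N.
  move=> p_pr /eqP l_m; rewrite -(prednK j_gt0); apply: (H_logn p_pr).
  by rewrite l_m H_tet prednK.
have le : INR (count_upto (fun n => logn 2 n == m) N) + INR (count_upto (fun n => logn 3 n == m) N) <=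
    INR (count_upto (fun n => j < H n)%N N) + INR (count_upto (dvdn (2 ^ m * 3 ^ m)) N).
  rewrite !count_uptoE -!big_split; apply: Rsum_nat_le => n /andP[n_gt0 _] /=.
  have := b2R_bounds (2 ^ m * 3 ^ m %| n)%N.
  case l2: (logn 2 n == m); case l3: (logn 3 n == m) => /=.
  - rewrite (logn_H _ _ _ l2) // Gauss_dvd ?coprimeXl ?coprimeXr // !pfactor_dvdn //.
    by rewrite (eqP l2) (eqP l3) leqnn /=; lra.
  - by rewrite (logn_H _ _ _ l2) //=; lra.
  - by rewrite (logn_H _ _ _ l3) //=; lra.
  by have := b2R_bounds (j < H n)%N; lra.
have /Rabs_le_between := @count_logn 2 m N isT.
have /Rabs_le_between := @count_logn 3 m N isT.
have q_gt0 : (0 < 2 ^ m * 3 ^ m)%N by rewrite muln_gt0 !expn_gt0.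
have [_] := count_dvd N q_gt0; move: le.
rewrite mult_INR !INR_expn -!tech_pow_Rmult -[INR 2]/2 (_ : INR 3 = 3); last by rewrite /=; ring.
rewrite /Rdiv !Rinv_mult; set x := / 2 ^ m; set y := / 3 ^ m; lra.
Qed.

(** Five sets cover {H > j}: v_2(n) = m, v_3(n) = m, the multiples of 2^(2m) and of 3^(2m), to which
    [H_ge_gap] relegates every other exponent of 2 and 3, and the n divisible by p^m for some p >=
    5. The last one has weight 1 / ((m - 1) 4^(m-1)). *)
Lemma Htail_le_sharp j : (1 < j)%N -> let m := tet 2 j in
  Htail j <= / 2 ^ m * (/ 2) + / 3 ^ m * (2 / 3) + (/ 2 ^ m) ^ 2 + (/ 3 ^ m) ^ 2 +
             4 * (/ 2 ^ m) ^ 2 * / INR m.-1.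
Proof.
move=> j_gt1 m.
have m_ge4 : (4 <= m)%N by apply: (tet_leq j_gt1).
have m1 : m = m.-1.+1 by rewrite prednK // ltnW // ltnW // ltnW.
have pow_gt0 p k : prime p -> (0 < p ^ k)%N by move=> p_pr; rewrite expn_gt0 prime_gt0.
have h : count_le (fun n => j < H n)%N
   ((/ INR 2 ^ m - / INR 2 ^ m.+1) + ((/ INR 3 ^ m - / INR 3 ^ m.+1) +
     (/ INR (2 ^ (2 * m)) + (/ INR (3 ^ (2 * m)) + / (INR m.-1 * INR 4 ^ m.-1))))).
  apply: count_le_or (count_le_logn m (isT : prime 2)) (count_le_orb (count_le_logn m (isT : prime 3))
   (count_le_orb (count_le_dvd (pow_gt0 2 (2 * m) isT)) (count_le_orb (count_le_dvd (pow_gt0 3 (2 * m) isT))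
     (count_le_large_pow _ _))))%N => // [n n_gt0 hj|]; last by rewrite -ltnS -m1 ltnW // ltnW.
  have [p [p_pr l_gt0 jl]] := H_gt hj.
  have dv k : (k <= logn p n)%N -> (p ^ k %| n)%N by rewrite pfactor_dvdn.
  have ml : (m <= logn p n)%N by apply: tet_leq_of_H.
  have gap : logn p n != m -> (p ^ (2 * m) %| n)%N.
    by move=> neq; apply: dv; apply: H_ge_gap.
  have [p2|p2] := eqVneq p 2%N.
    by rewrite p2 in gap; case: eqP gap => //= _ ->; rewrite ?orbT.
  have [p3|p3] := eqVneq p 3%N.
    by rewrite p3 in gap; case: (logn 3 n == m) gap => //= [|->]; rewrite ?orbT.
  have p5 : (5 <= p)%N by case: p p_pr p2 p3 {l_gt0 jl dv ml gap} => [|[|[|[|[|p]]]]].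
  by rewrite -m1 (large_powI _ n_gt0 p5 (dv m ml)) ?orbT // ltnW // ltnW // ltnW.
apply: Rle_trans (density_count_le (@density_H_gt j) h) _.
have pos2 := Rinv_0_lt_compat _ (pow_lt 2 m Rlt_0_2).
have e2 : / INR (2 ^ (2 * m)) = (/ 2 ^ m) ^ 2.
  by rewrite INR_expn mulnC -multE -[INR 2]/2 pow_mult pow_inv.
have e3 : / INR (3 ^ (2 * m)) = (/ 3 ^ m) ^ 2.
  by rewrite INR_expn mulnC -multE (_ : INR 3 = 3) ?pow_mult ?pow_inv //= ; ring.
have e4 : / (INR m.-1 * INR 4 ^ m.-1) = 4 * (/ 2 ^ m) ^ 2 * / INR m.-1.
  have -> : INR 4 = 2 * 2 by rewrite /=; ring.
  rewrite Rpow_mult_distr (_ : 2 ^ m = 2 * 2 ^ m.-1); last by rewrite {1}m1.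
  have : 0 < 2 ^ m.-1 by apply: pow_lt; lra.
  have : 0 < INR m.-1 by apply/lt_0_INR/ltP; rewrite -ltnS -m1 ltnW // ltnW.
  by move=> ? ?; field; lra.
rewrite e2 e3 e4 -!tech_pow_Rmult -[INR 2]/2 (_ : INR 3 = 3); last by rewrite /=; ring.
rewrite !Rinv_mult; set x := / 2 ^ m; set y := / 3 ^ m; apply: Req_le; field.
by apply/Rgt_not_eq/lt_0_INR/ltP; rewrite -ltnS -m1 ltnW // ltnW.
Qed.

Lemma c1_termE j : c1_term j = 2 ^ tet 2 j * (Htail j - Htail j.+1) - / 2.
Proof. by rewrite /c1_term DensE tetS INR_expn -[INR 2]/2; lra. Qed.

Lemma pow_inv_mul x n : 0 < x -> x ^ n * / x ^ n = 1.
Proof. by move=> x_gt0; apply: Rinv_r; apply: pow_nonzero; lra. Qed.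

Lemma c1_term_le_sharp j : (1 < j)%N -> let m := tet 2 j in
  c1_term j <= (2 / 3) ^ m * (2 / 3) + / 2 ^ m * (1 + 4 / INR m.-1) + (2 / 3) ^ m * / 3 ^ m.
Proof.
move=> j_gt1 m; rewrite c1_termE -/m; have := Htail_le_sharp j_gt1; rewrite /= -/m.
have := Htail_ge0 j.+1; have x_pos : 0 < 2 ^ m by apply: pow_lt; lra.
have -> : (2 / 3) ^ m = 2 ^ m * / 3 ^ m by rewrite Rpow_mult_distr pow_inv.
have := pow_inv_mul m Rlt_0_2; rewrite /Rdiv; set x := 2 ^ m in x_pos *; set y := / x.
set z := / 3 ^ m; set w := / INR m.-1; move=> xy1 t_ge0 t_le.
have := Rmult_le_compat_l _ _ _ (Rlt_le _ _ x_pos) t_le.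
have := Rmult_le_pos _ _ (Rlt_le _ _ x_pos) t_ge0.
have -> : x * (y * / 2 + z * (2 * / 3) + y * (y * 1) + z * (z * 1) + 4 * (y * (y * 1)) * w) =
   (x * y) * / 2 + x * z * (2 * / 3) + (x * y) * y + x * z * z + 4 * (x * y) * y * w by ring.
rewrite xy1; lra.
Qed.

(** For m = 2^^j the left side is, up to a factor 3, what [Htail j.+1] can contribute to
    [c1_term j]. The reason is 2m <= 2^m. *)
Lemma pow2_tail_small m : 2 ^ m * / 2 ^ (2 ^ m)%N <= / 2 ^ m.
Proof.
have dbl : (m + m <= 2 ^ m)%N.
  case: m => // m; rewrite addnn -mul2n expnS leq_mul2l /=.
  by apply: ltn_expl.
have -> : / 2 ^ m = 2 ^ m * / 2 ^ (m + m)%N.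
  have x_pos : 0 < 2 ^ m by apply: pow_lt; lra.
  by rewrite -plusE pow_add; field; lra.
apply: Rmult_le_compat_l; first by apply: pow_le; lra.
apply: Rinv_le_contravar; first by apply: pow_lt; lra.
by apply: Rle_pow; [lra | apply/leP].
Qed.

Lemma c1_term_ge_sharp j : (0 < j)%N -> let m := tet 2 j in
  (2 / 3) ^ m * (2 / 3) - / 3 ^ m - 3 * (2 ^ m * / 2 ^ tet 2 j.+1) <= c1_term j.
Proof.
move=> j_gt0 m; rewrite c1_termE -/m; have := Htail_ge j_gt0; rewrite /= -/m.
have := @Htail_le j.+1 isT; have x_pos : 0 < 2 ^ m by apply: pow_lt; lra.
have -> : (2 / 3) ^ m = 2 ^ m * / 3 ^ m by rewrite Rpow_mult_distr pow_inv.
rewrite -tetS; have := pow_inv_mul m Rlt_0_2; rewrite /Rdiv.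
set x := 2 ^ m in x_pos *; set y := / x.
set z := / 3 ^ m; set w := / 2 ^ tet 2 j.+1; move=> xy1 t_le t_ge.
have := Rmult_le_compat_l _ _ _ (Rlt_le _ _ x_pos) t_le.
have := Rmult_le_compat_l _ _ _ (Rlt_le _ _ x_pos) t_ge.
have -> : x * (y * / 2 + z * (2 * / 3) - y * z) = (x * y) * / 2 + x * z * (2 * / 3) - (x * y) * z by ring.
rewrite xy1; lra.
Qed.

(** Both 2^-m and 3^-m are below (2/3)^m, and m >= 4 gives 4 / (m - 1) <= 4/3; the constant 7 leaves
    room. *)
Lemma c1_term_abs_le j : (1 < j)%N -> Rabs (c1_term j) <= 7 * (2 / 3) ^ tet 2 j.
Proof.
move=> j_gt1; have := c1_term_le_sharp j_gt1; have := c1_term_ge_sharp (ltnW j_gt1).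
have := pow2_tail_small (tet 2 j); rewrite tetS /=.
have m_ge4 : (4 <= tet 2 j)%N by apply: (tet_leq j_gt1).
set m := tet 2 j in m_ge4 *.
have le2 : / 2 ^ m <= (2 / 3) ^ m by rewrite -pow_inv; apply: pow_incr; lra.
have le3 : / 3 ^ m <= (2 / 3) ^ m by rewrite -pow_inv; apply: pow_incr; lra.
have le31 : / 3 ^ m <= 1 by rewrite -pow_inv -(pow1 m); apply: pow_incr; lra.
have p2 := Rinv_0_lt_compat _ (pow_lt 2 m Rlt_0_2).
have p3 : 0 < / 3 ^ m by apply/Rinv_0_lt_compat/pow_lt; lra.
have w1 : 4 / INR m.-1 <= 4 / 3.
  apply: Rmult_le_compat_l; first lra.
  apply: Rinv_le_contravar; first lra.
  have -> : 3 = INR 3 by rewrite /=; ring.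
  by apply: leq_INR; rewrite -ltnS prednK // ltnW // ltnW // ltnW.
have w0 : 0 < 4 / INR m.-1.
  apply: Rdiv_lt_0_compat; first lra.
  by apply/lt_0_INR/ltP; rewrite -ltnS prednK // ltnW // ltnW // ltnW.
set u := (2 / 3) ^ m in le2 le3 *; set a := / 2 ^ m in le2 p2 *; set b := / 3 ^ m in le3 le31 p3 *.
set c := 4 / _ in w0 w1 *; set d := _ * / _ => hd hge hle.
by apply: Rabs_le; nra.
Qed.

(** The explicit estimate starts at j = 2; the ratios at j = 0 and j = 1 are simply added to its
    constant. *)
Lemma c1_term_bounded : exists2 K, 0 < K &
  forall j, Rabs (c1_term j) <= K * (2 / 3) ^ tet 2 j.
Proof.
have p j : 0 < (2 / 3) ^ tet 2 j by apply: pow_lt; lra.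
pose r j := Rabs (c1_term j) / (2 / 3) ^ tet 2 j.
have r_ge0 j : 0 <= r j by apply: Rcomplements.Rdiv_le_0_compat (Rabs_pos _) (p j).
exists (7 + r 0%N + r 1%N); first by have := r_ge0 0%N; have := r_ge0 1%N; lra.
have rE j : Rabs (c1_term j) = r j * (2 / 3) ^ tet 2 j.
  by rewrite /r; have := p j => ?; field; lra.
have h0 := r_ge0 0%N; have h1 := r_ge0 1%N.
case=> [|[|j]]; rewrite ?rE; try (apply: Rmult_le_compat_r; [exact/Rlt_le/p | lra]).
rewrite -rE; apply: Rle_trans (@c1_term_abs_le j.+2 isT) _.
apply: Rmult_le_compat_r; [exact/Rlt_le/p | lra].
Qed.

(** As 2^^(M+k) >= 2^^M + k, the tail is dominated by a geometric series of ratio 2/3, whose sum is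
    the factor 3. *)
Lemma c1_tail K M : 0 <= K ->
  (forall j, (M <= j)%N -> Rabs (c1_term j) <= K * (2 / 3) ^ tet 2 j) ->
  ex_series (fun k => c1_term (M + k)) /\
  Rabs (Series (fun k => c1_term (M + k))) <= 3 * K * (2 / 3) ^ tet 2 M.
Proof.
move=> K_ge0 hK; pose g k := K * (2 / 3) ^ tet 2 M * (2 / 3) ^ k.
have q1 : Rabs (2 / 3) < 1 by rewrite Rabs_pos_eq; lra.
have le_g k : 0 <= Rabs (c1_term (M + k)) <= g k.
  split; first exact: Rabs_pos.
  apply: Rle_trans (hK _ (leq_addr _ _)) _; rewrite /g Rmult_assoc -pow_add -plusE.
  apply: Rmult_le_compat_l => //.
  have := tet_addl M k => /leP/Nat.sub_add <-; rewrite pow_add.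
  rewrite -{2}[(2 / 3) ^ (tet 2 M + k)]Rmult_1_l; apply: Rmult_le_compat_r.
    by apply: pow_le; lra.
  by rewrite -(pow1 (tet 2 (M + k) - (tet 2 M + k))); apply: pow_incr; lra.
have ex_g : ex_series g by apply: ex_series_scal_l; apply: ex_series_geom.
have ex_abs : ex_series (fun k => Rabs (c1_term (M + k))).
  by apply: ex_series_le ex_g => k; rewrite /norm /= /abs /= Rabs_Rabsolu; case: (le_g k).
split; first exact: ex_series_Rabs.
apply: Rle_trans (Series_Rabs _ ex_abs) _.
apply: Rle_trans (Series_le _ _ le_g ex_g) _.
by rewrite /g Series_scal_l Series_geom //; apply: Req_le; field.
Qed.

Lemma ex_series_c1 : ex_series c1_term.
Proof.
have [K K_gt0 hK] := c1_term_bounded.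
by have [] := @c1_tail K 0%N (Rlt_le _ _ K_gt0) (fun j _ => hK j).
Qed.

(** * The density of the squarefree numbers *)

Lemma density_big_sum K (P : nat -> pred nat) (l : nat -> R) :
  (forall d, (0 < d)%N -> density (P d) (l d)) ->
  is_lim_seq (fun N => \sum_(1 <= d < K.+1) (INR (count_upto (P d) N) / INR N))
             (Rbar.Finite (\sum_(1 <= d < K.+1) l d)).
Proof.
move=> h; elim: K => [|K IHK].
  rewrite Rsum_nat1; apply: (is_lim_seq_ext (fun=> 0)); last exact: is_lim_seq_const.
  by move=> N; rewrite Rsum_nat1.
rewrite Rsum_nat_recr.
apply: (is_lim_seq_ext (fun N => \sum_(1 <= d < K.+1) (INR (count_upto (P d) N) / INR N) +
  INR (count_upto (P K.+1) N) / INR N)); first by move=> N; rewrite Rsum_nat_recr.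
by apply: is_lim_seq_plus'; last exact: h.
Qed.

(** It says that n = s d^2 with s squarefree. Each positive n has exactly one such d, and the class
    of d has density Q_1 / d^2, so Q_1 times the sum of 1 / d^2 must be 1. *)
Definition square_part (d n : nat) : bool := (d ^ 2 %| n)%N && (H (n %/ d ^ 2) <= 1)%N.

Lemma H_le1 n : (H n <= 1)%N = exps_in (fun a => H a <= 0)%N n.
Proof. exact: H_leS. Qed.

Lemma H_le1_logn p n : prime p -> (H n <= 1)%N -> (logn p n <= 1)%N.
Proof.
move=> p_pr /H_leSP/(_ p p_pr); by case: (logn p n) => [|[|a]].
Qed.

Lemma square_part_ex n : (0 < n)%N -> exists2 d, (0 < d)%N & square_part d n.
Proof.
suff h : (0 < n)%N -> exists d s, [/\ (0 < d)%N, n = (s * d ^ 2)%N & (H s <= 1)%N].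
  move=> /h[d [s [d_gt0 -> hs]]]; exists d => //.
  by rewrite /square_part dvdn_mull // mulnK // expn_gt0 d_gt0.
move: n; apply: coprime_part_ind => [|p v m p_pr v_gt0 m_gt0 pNm [d [s [d_gt0 def_m hs]]]].
  by exists 1%N, 1%N.
have p_gt0 := prime_gt0 p_pr.
exists (d * p ^ v./2)%N, (s * p ^ odd v)%N; split.
- by rewrite muln_gt0 d_gt0 expn_gt0 p_gt0.
- rewrite def_m expnMn -expnM muln2 mulnACA -expnD odd_double_half.
  by [].
have s_gt0 : (0 < s)%N by move: m_gt0; rewrite def_m muln_gt0 => /andP[].
case: (odd v) => /=; last by rewrite muln1.
rewrite H_le1 exps_in_part //= -?H_le1 //.
by apply: contra pNm => ps; rewrite def_m dvdn_mulr.
Qed.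

(** At each prime, v_p(n) = v_p(s) + 2 v_p(d) with v_p(s) <= 1: the parity of v_p(n) determines
    v_p(s), hence v_p(d). *)
Lemma square_part_uniq d e n : (0 < n)%N -> square_part d n -> square_part e n -> d = e.
Proof.
move=> n_gt0 /andP[/divnK dn hs] /andP[/divnK en ht].
move: hs ht dn en; set s := (_ %/ _)%N; set t := (_ %/ _)%N => hs ht dn en.
have gt0 u c : (u * c ^ 2)%N = n -> (0 < u)%N /\ (0 < c)%N.
  by move=> def_n; move: n_gt0; rewrite -def_n muln_gt0 expn_gt0 orbF => /andP.
have [s_gt0 d_gt0] := gt0 _ _ dn; have [t_gt0 e_gt0] := gt0 _ _ en.
apply: eqn_from_log => // p; have [p_pr|p_npr] := boolP (prime p); last first.
  by rewrite (lognE p d) (lognE p e) (negPf p_npr).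
have := congr1 (logn p) (etrans dn (esym en)).
have logE u c : (0 < u)%N -> (0 < c)%N -> logn p (u * c ^ 2) = (logn p u + 2 * logn p c)%N.
  by move=> u_gt0 c_gt0; rewrite lognM // ?lognX // expn_gt0 c_gt0.
rewrite !logE //.
have := H_le1_logn p_pr hs; have := H_le1_logn p_pr ht.
move: (logn p s) (logn p t) (logn p d) (logn p e) => [|[|?]] [|[|?]] // x y _ _.
- by rewrite !add0n => /eqP; rewrite eqn_pmul2l // => /eqP.
- by rewrite !mul2n => /(congr1 odd); rewrite !oddD !odd_double.
- by rewrite !mul2n => /(congr1 odd); rewrite !oddD !odd_double.
by rewrite !add1n => -[] /eqP; rewrite eqn_pmul2l // => /eqP.
Qed.

Lemma density_square_part d : (0 < d)%N -> density (square_part d) (Hdens 1 / INR d ^ 2).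
Proof.
move=> d_gt0; rewrite -INR_expn.
by apply: (density_multiples _ (@density_H_le 1)); rewrite expn_gt0 d_gt0.
Qed.

Lemma sum_count_div K (P : nat -> pred nat) N :
  \sum_(1 <= d < K.+1) (INR (count_upto (P d) N) / INR N) =
  (\sum_(1 <= n < N.+1) \sum_(1 <= d < K.+1) b2R (P d n)) / INR N.
Proof.
rewrite exchange_big /= /Rdiv Rmult_comm -Rsum_mulr; apply: eq_bigr => d _.
by rewrite count_uptoE Rmult_comm.
Qed.

Definition inv_sq_sum K := \sum_(1 <= d < K.+1) / INR d ^ 2.

Lemma sqfree_density_ub K : Hdens 1 * inv_sq_sum K <= 1.
Proof.
have := @density_big_sum K _ _ density_square_part.
rewrite Rsum_mulr => lim.
apply: (is_lim_seq_le_loc _ _ (Rbar.Finite _) (Rbar.Finite _) _ lim (is_lim_seq_const 1)).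
apply: eventually_gt0 => N N_gt0; have N_pos : 0 < INR N by apply/lt_0_INR/ltP.
rewrite sum_count_div; apply/Rcomplements.Rle_div_l => //; rewrite Rmult_1_l.
apply: (@Rle_trans _ (\sum_(1 <= n < N.+1) 1)); last first.
  have := count_uptoE predT N; rewrite /= => <-.
  by rewrite /count_upto count_predT size_iota; lra.
apply: Rsum_nat_le => n /andP[n_gt0 _].
have [d d_gt0 hd] := square_part_ex n_gt0.
have other e : e != d -> b2R (square_part e n) = 0.
  move=> e_neq; case he: (square_part e n) => //.
  by rewrite (square_part_uniq n_gt0 he hd) eqxx in e_neq.
have [dK|dK] := leqP d K.
  rewrite (bigD1_seq d) ?iota_uniq ?mem_index_iota ?d_gt0 //= hd /= big1 => [|e /other //].
  lra.
rewrite big_nat big1 => [|e /andP[_ eK]]; first lra.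
by apply: other; rewrite neq_ltn (leq_trans eK).
Qed.

(** An n outside all classes d <= K is divisible by the square of some d > K, and at most N / K
    integers up to N are. *)
Lemma sqfree_density_lb K : (0 < K)%N -> 1 - / INR K <= Hdens 1 * inv_sq_sum K.
Proof.
move=> K_gt0; have := @density_big_sum K _ _ density_square_part.
rewrite Rsum_mulr => lim.
apply: (is_lim_seq_le_loc _ _ (Rbar.Finite _) (Rbar.Finite _) _ (is_lim_seq_const _) lim).
apply: eventually_gt0 => N N_gt0; have N_pos : 0 < INR N by apply/lt_0_INR/ltP.
rewrite sum_count_div; apply/Rcomplements.Rle_div_r => //.
have := @count_large_pow K 1 N K_gt0 isT; rewrite [INR 1]/= Rmult_1_l pow_1 => hl.
suff : INR N <= (\sum_(1 <= n < N.+1) \sum_(1 <= d < K.+1) b2R (square_part d n)) +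
   INR (count_upto (large_pow K.+1 2) N) by lra.
have -> : INR N = \sum_(1 <= n < N.+1) 1.
  have := count_uptoE predT N; rewrite /= => <-.
  by rewrite /count_upto count_predT size_iota.
rewrite count_uptoE -big_split /=; apply: Rsum_nat_le => n /andP[n_gt0 _].
have [d d_gt0 hd] := square_part_ex n_gt0.
have nonneg (P : pred nat) : 0 <= \sum_(1 <= d < K.+1 | P d) b2R (square_part d n).
  by apply: Rsum_ge0 => e _ _; case: (b2R_bounds (square_part e n)).
have := nonneg predT; have [dK|dK] := leqP d K.
  rewrite (bigD1_seq d) ?iota_uniq ?mem_index_iota ?d_gt0 //= hd /=.
  by have := nonneg (fun i => i != d); have := b2R_bounds (large_pow K.+1 2 n); lra.
rewrite (@large_powI K.+1 2 n d) //=; first lra.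
by case/andP: hd.
Qed.

(** Both sides telescope. The midpoint shift 1/2 makes the upper one accurate to a higher order; it
    yields the lower bound for Q_1, the delicate side since Q_1 enters c_1 with weight -2 and c_1 is
    just below 1814/1000. *)
Lemma inv_sq_sum_bounds n k :
  inv_sq_sum n.+1 + / INR n.+2 - / INR (n.+2 + k) <= inv_sq_sum (n.+1 + k) <=
  inv_sq_sum n.+1 + / (INR n.+1 + / 2).
Proof.
have p j : 0 < INR (n.+1 + j) by rewrite addSn; apply: INR_S_gt0.
suff [h1 h2] : inv_sq_sum n.+1 + / INR n.+2 - / INR (n.+2 + k) <= inv_sq_sum (n.+1 + k) <=
  inv_sq_sum n.+1 + / (INR n.+1 + / 2) - / (INR (n.+1 + k) + / 2).
  split => //; apply: Rle_trans h2 _.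
  have : 0 < / (INR (n.+1 + k) + / 2) by apply: Rinv_0_lt_compat; have := p k; lra.
  lra.
elim: k => [|k [IH1 IH2]]; first by rewrite !addn0; lra.
rewrite !addnS; rewrite -[(n.+2 + k)%N]/(n.+1 + k).+1 in IH1 *.
have -> : inv_sq_sum (n.+1 + k).+1 = inv_sq_sum (n.+1 + k) + / INR (n.+1 + k).+1 ^ 2.
  exact: Rsum_nat_recr.
rewrite !(S_INR (n.+1 + k).+1) !(S_INR (n.+1 + k)) in IH1 IH2 *.
move: (INR (n.+1 + k)) (p k) IH1 IH2 => x x_pos IH1 IH2.
have -> : / (x + 1) ^ 2 = / ((x + 1) * (x + 1)) by congr Rinv; ring.
have e1 : / (x + 1) - / (x + 1 + 1) = / ((x + 1) * (x + 2)) by field; lra.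
have e2 : / (x + / 2) - / (x + 1 + / 2) = / ((x + / 2) * (x + 3 / 2)) by field; lra.
have : / ((x + 1) * (x + 2)) <= / ((x + 1) * (x + 1)) by apply: Rinv_le_contravar; nra.
have : / ((x + 1) * (x + 1)) <= / ((x + / 2) * (x + 3 / 2)) by apply: Rinv_le_contravar; nra.
lra.
Qed.

Lemma Hdens1_ub n : Hdens 1 * (inv_sq_sum n.+1 + / INR n.+2) <= 1.
Proof.
have d_ge0 : 0 <= Hdens 1.
  apply: (density_count_ge (@density_H_le 1)); exists 0 => N.
  by rewrite Rmult_0_l Rminus_0_r; apply: pos_INR.
have lim : is_lim_seq (fun k => Hdens 1 * (inv_sq_sum n.+1 + / INR n.+2 - / INR (n.+2 + k)))
    (Rbar.Finite (Hdens 1 * (inv_sq_sum n.+1 + / INR n.+2))).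
  rewrite -{2}[_ + / INR n.+2]Rminus_0_r.
  apply: (is_lim_seq_scal_l _ _ (Rbar.Finite _)); apply: is_lim_seq_minus'; first exact: is_lim_seq_const.
  apply: (is_lim_seq_ext (fun k => / INR (k + n.+2)%N)); first by move=> k; rewrite addnC.
  apply/(is_lim_seq_incr_n (fun k => / INR k)).
  apply: (is_lim_seq_ext (fun k => 1 / INR k)); first by move=> k; rewrite /Rdiv Rmult_1_l.
  exact: is_lim_seq_div_INR.
apply: (is_lim_seq_le_loc _ _ (Rbar.Finite _) (Rbar.Finite _) _ lim (is_lim_seq_const 1)).
exists 0%N => k _; apply: Rle_trans (sqfree_density_ub (n.+1 + k)).
by apply: Rmult_le_compat_l => //; case: (inv_sq_sum_bounds n k).
Qed.

Lemma Hdens1_lb n : 1 <= Hdens 1 * (inv_sq_sum n.+1 + / (INR n.+1 + / 2)).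
Proof.
have d_ge0 : 0 <= Hdens 1.
  apply: (density_count_ge (@density_H_le 1)); exists 0 => N.
  by rewrite Rmult_0_l Rminus_0_r; apply: pos_INR.
have lim : is_lim_seq (fun k => 1 - / INR (n.+1 + k)) (Rbar.Finite 1).
  rewrite -{2}[1]Rminus_0_r; apply: is_lim_seq_minus'; first exact: is_lim_seq_const.
  apply: (is_lim_seq_ext (fun k => / INR (k + n.+1)%N)); first by move=> k; rewrite addnC.
  apply/(is_lim_seq_incr_n (fun k => / INR k)).
  apply: (is_lim_seq_ext (fun k => 1 / INR k)); first by move=> k; rewrite /Rdiv Rmult_1_l.
  exact: is_lim_seq_div_INR.
apply: (is_lim_seq_le_loc _ _ (Rbar.Finite _) (Rbar.Finite _) _ lim (is_lim_seq_const _)).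
exists 0%N => k _; apply: Rle_trans (@sqfree_density_lb (n.+1 + k) isT) _.
by apply: Rmult_le_compat_l => //; case: (inv_sq_sum_bounds n k).
Qed.

(* Unreduced integer fractions leave the numerical comparisons to [vm_compute]. *)
Fixpoint inv_sq_frac (n : nat) : Z * Z :=
  if n is n'.+1 then
    let: (a, b) := inv_sq_frac n' in
    let d2 := Z.mul (Z.of_nat n) (Z.of_nat n) in
    (Z.add (Z.mul a d2) b, Z.mul b d2)
  else (0, 1)%Z.

Lemma inv_sq_fracE n : IZR (inv_sq_frac n).2 <> 0 /\
  inv_sq_sum n = IZR (inv_sq_frac n).1 / IZR (inv_sq_frac n).2.
Proof.
elim: n => [|n [IH0 IHn]]; first by rewrite /inv_sq_sum Rsum_nat1 /=; lra.
rewrite [inv_sq_sum _]Rsum_nat_recr -/(inv_sq_sum n) IHn.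
pose d2 := Z.mul (Z.of_nat n.+1) (Z.of_nat n.+1).
have -> : inv_sq_frac n.+1 = let: (a, b) := inv_sq_frac n in
    (Z.add (Z.mul a d2) b, Z.mul b d2) by [].
case: (inv_sq_frac n) IH0 {IHn} => a b; cbn [fst snd] => b_neq0.
rewrite plus_IZR !mult_IZR -!INR_IZR_INZ.
have := INR_S_gt0 n; move: (INR n.+1) => x x_gt0.
split; last by field; lra.
by repeat (apply: Rmult_integral_contrapositive_currified; try lra).
Qed.

(** Forty terms suffice: with the midpoint tail 2/81 the lower bound is good to about six digits,
    while the cruder tail 1/41 is enough for the upper one. *)
Lemma Hdens1_bounds : 607926 / 1000000 <= Hdens 1 <= 60804 / 100000.
Proof.
have hZ : 1620243963 / 1000000000 <= inv_sq_sum 40 <= 1620243964 / 1000000000.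
  have [_ ->] := inv_sq_fracE 40.
  set f := inv_sq_frac 40; vm_compute in f; rewrite /f /=; split; lra.
have := Hdens1_lb 39; have := Hdens1_ub 39.
have -> : / (INR 40 + / 2) = 2 / 81 by rewrite INR_IZR_INZ /=; field.
have -> : / INR 41 = / 41 by rewrite INR_IZR_INZ.
move: (inv_sq_sum 40) (Hdens 1) hZ => z q [z_lo z_hi] ub lb.
have q_gt0 : 0 < q.
  apply: (Rmult_lt_reg_r (z + 2 / 81)); first lra.
  by rewrite Rmult_0_l; lra.
have := Rmult_le_compat_l q _ _ (Rlt_le _ _ q_gt0) z_lo.
have := Rmult_le_compat_l q _ _ (Rlt_le _ _ q_gt0) z_hi.
by move=> ? ?; split; lra.
Qed.

(** * A finite sieve for the numbers of height at most 2 *)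

Definition pmul_invariant (p : nat) (P : pred nat) : Prop :=
  forall n, (0 < n)%N -> P (p * n)%N = P n.

(** Independence of p: imposing g on v_p(n) multiplies by delta the density of any set blind to p.
    Conditions at distinct primes can thus be imposed one after another. *)
Definition local_density (p : nat) (g : pred nat) (delta : R) : Prop :=
  forall P d, pmul_invariant p P -> density P d ->
    density (fun n => P n && g (logn p n)) (d * delta).

Lemma density_pow_dvd p a P d : prime p -> pmul_invariant p P -> density P d ->
  density (fun n => P n && (p ^ a %| n)%N) (d * / INR p ^ a).
Proof.
move=> p_pr invP hd; have p_gt0 := prime_gt0 p_pr.
have pa_gt0 : (0 < p ^ a)%N by rewrite expn_gt0 p_gt0.
rewrite -INR_expn; apply: eq_density (density_multiples pa_gt0 hd) => n n_gt0.
rewrite andbC; case: (boolP (p ^ a %| n)%N) => // pan; rewrite ?andbF ?andbT //.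
have invPa c : (0 < c)%N -> P (p ^ a * c)%N = P c.
  move=> c_gt0; elim: a {pa_gt0 pan} => [|a IHa]; first by rewrite mul1n.
  by rewrite expnS -mulnA invP // muln_gt0 expn_gt0 p_gt0 c_gt0.
rewrite -[in RHS](divnK pan) mulnC invPa // divn_gt0 //; exact: dvdn_leq.
Qed.

Lemma eq_local_density p g1 g2 delta :
  g1 =1 g2 -> local_density p g1 delta -> local_density p g2 delta.
Proof.
move=> eg h P d invP hd; apply: eq_density (h P d invP hd) => n _ /=.
by rewrite eg.
Qed.

Lemma local_density_true p : local_density p predT 1.
Proof.
by move=> P d _ hd; rewrite Rmult_1_r; apply: eq_density hd => n _ /=; rewrite andbT.
Qed.

Lemma local_density_lt p L : prime p ->
  local_density p (fun v => v < L)%N (1 - / INR p ^ L).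
Proof.
move=> p_pr P d invP hd; rewrite Rmult_minus_distr_l Rmult_1_r.
apply: (density_diff _ hd (density_pow_dvd (a := L) p_pr invP hd)) => n n_gt0 /=.
by rewrite pfactor_dvdn // ltnNge; case: (P n) (L <= logn p n)%N => [] [] /=; lra.
Qed.

Lemma local_density_remove p g delta a : prime p -> local_density p g delta -> g a ->
  local_density p (fun v => g v && (v != a)) (delta - (/ INR p ^ a - / INR p ^ a.+1)).
Proof.
move=> p_pr hg ga P d invP hd.
have ha : density (fun n => P n && (logn p n == a)) (d * / INR p ^ a - d * / INR p ^ a.+1).
  apply: (density_diff _ (density_pow_dvd (a := a) p_pr invP hd) (density_pow_dvd (a := a.+1) p_pr invP hd)) => n n_gt0.
  by rewrite !b2R_and b2R_logn //; ring.
rewrite Rmult_minus_distr_l (Rmult_minus_distr_l d (/ _)).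
apply: (density_diff _ (hg P d invP hd) ha) => n n_gt0.
have [->|neq] := eqVneq (logn p n) a; rewrite ?ga /=; case: (P n) => /=; try lra.
by case: (g _) => /=; lra.
Qed.

(* [L = 0] stands for no upper bound on the exponent. *)
Definition sieve_exp (ex : seq nat) (L v : nat) : bool :=
  ((L == 0) || (v < L))%N && (v \notin ex).

Fixpoint sieve_factor (p : nat) (ex : seq nat) (L : nat) : R :=
  if ex is a :: ex' then sieve_factor p ex' L - (/ INR p ^ a - / INR p ^ a.+1)
  else if L == 0%N then 1 else 1 - / INR p ^ L.

Lemma local_density_sieve p ex L : prime p -> uniq ex ->
  all (fun a => (L == 0) || (a < L))%N ex ->
  local_density p (sieve_exp ex L) (sieve_factor p ex L).
Proof.
move=> p_pr; elim: ex => [|a ex IH] /=.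
  move=> _ _; have [->|L_neq0] := eqVneq L 0%N.
    apply: (eq_local_density _ (@local_density_true p)) => v.
    by rewrite /sieve_exp eqxx.
  apply: (eq_local_density _ (local_density_lt (L := L) p_pr)) => v.
  by rewrite /sieve_exp (negPf L_neq0) andbT.
move=> /andP[a_nin u] /andP[aL exL].
apply: eq_local_density (local_density_remove p_pr (IH u exL) _); last first.
  by rewrite /sieve_exp aL.
by move=> v; rewrite /sieve_exp inE negb_or -andbA; congr andb; rewrite andbC.
Qed.

(** An entry consists of a prime p, the excluded values of v_p(n), and a strict upper bound on
    v_p(n). *)
Definition sieve (l : seq (nat * seq nat * nat)) (n : nat) : bool :=
  all (fun c => sieve_exp c.1.2 c.2 (logn c.1.1 n)) l.

Definition sieve_density (l : seq (nat * seq nat * nat)) : R :=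
  foldr (fun c d => d * sieve_factor c.1.1 c.1.2 c.2) 1 l.

Definition sieve_wf (l : seq (nat * seq nat * nat)) : bool :=
  uniq [seq c.1.1 | c <- l] &&
  all (fun c => [&& prime c.1.1, uniq c.1.2 &
    all (fun a => (c.2 == 0) || (a < c.2))%N c.1.2]) l.

Lemma density_sieve l : sieve_wf l -> density (sieve l) (sieve_density l).
Proof.
elim: l => [|[[p ex] L] l IHl]; first by move=> _; apply: density_true.
move=> /andP[/= /andP[p_nin u] /andP[/and3P[p_pr uex exL] wf_l]].
have hl : density (sieve l) (sieve_density l) by apply: IHl; apply/andP.
have invP : pmul_invariant p (sieve l).
  move=> n n_gt0; apply: eq_in_all => -[[q qex] qL] q_in /=.
  rewrite (lognM _ (prime_gt0 p_pr) n_gt0) (logn_prime _ p_pr).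
  case: eqP => // qp; case/negP: p_nin; rewrite -qp.
  by apply/mapP; exists (q, qex, qL).
apply: eq_density (local_density_sieve p_pr uex exL invP hl) => n _ /=.
by rewrite andbC.
Qed.

(** B may lack a density: the limit is taken of the difference of the quotients for P and Q. *)
Lemma density_le_count P Q B p q b :
  (forall n, (0 < n)%N -> b2R (P n) <= b2R (Q n) + b2R (B n)) ->
  density P p -> density Q q -> count_le B b -> p <= q + b.
Proof.
move=> h hp hq [c hc]; suff : p - q <= b by lra.
have hbc : is_lim_seq (fun N => b + c / INR N) (Rbar.Finite b).
  rewrite -{2}(Rplus_0_r b); apply: is_lim_seq_plus'; first exact: is_lim_seq_const.
  exact: is_lim_seq_div_INR.
apply: (is_lim_seq_le_loc _ _ (Rbar.Finite _) (Rbar.Finite _) _ (is_lim_seq_minus' _ _ _ _ hp hq) hbc).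
apply: eventually_gt0 => N N_gt0; have N_pos : 0 < INR N by apply/lt_0_INR/ltP.
have := count_upto_lin_le N h; have := hc N => h1 h2.
rewrite /Rdiv -Rmult_minus_distr_r; apply/Rcomplements.Rle_div_l => //.
by rewrite Rmult_plus_distr_r Rmult_assoc Rinv_l ?Rmult_1_r; lra.
Qed.

(* [Hdens 2] has weight -12 in [c_1], and [c_1] is only 3.8e-5 below 1814/1000:
   the lower bound for [Hdens 2] must be good to a few units in the sixth digit. *)
Definition sieve2_lo : seq (nat * seq nat * nat) :=
  [:: (2, [:: 4; 8; 9; 12; 16; 18; 20; 24; 25], 27); (3, [:: 4; 8; 9; 12], 16);
      (5, [:: 4; 8; 9], 12); (7, [:: 4], 8); (11, [:: 4], 8); (13, [:: 4], 8);
      (17, [:: 4], 8); (19, [:: 4], 8); (23, [:: 4], 8); (29, [::], 4);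
      (31, [::], 4); (37, [::], 4); (41, [::], 4); (43, [::], 4); (47, [::], 4);
      (53, [::], 4); (59, [::], 4); (61, [::], 4); (67, [::], 4); (71, [::], 4);
      (73, [::], 4)]%N.

(** Only consequences of H(n) <= 2 are imposed, namely that a few exponents which are not squarefree
    do not occur at small primes. *)
Definition sieve2_hi : seq (nat * seq nat * nat) :=
  [:: (2, [:: 4; 8; 9; 12; 16; 18], 0); (3, [:: 4; 8; 9], 0); (5, [:: 4], 0);
      (7, [:: 4], 0); (11, [:: 4], 0); (13, [:: 4], 0)]%N.

(** H(n) <= 2 asks for exponents of height at most 1. All primes below 74 are listed, each excluding
    exactly the exponents of larger height below its cut-off; for p >= 74 the exponents 0 to 3 are
    harmless, and 4 or more is caught by [large_pow]. *)
Lemma sieve2_lo_H n : (0 < n)%N -> sieve sieve2_lo n -> ~~ large_pow 74 4 n ->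
  (H n <= 2)%N.
Proof.
move=> n_gt0 hs hl; apply/H_leSP => p p_pr.
have [p_ge|p_lt] := leqP 74 p.
  have : (logn p n < 4)%N.
    rewrite ltnNge; apply: contra hl => l4.
    by apply: (large_powI _ n_gt0 p_ge); rewrite // pfactor_dvdn.
  by case: (logn p n) => [|[|[|[|]]]].
have small : all (fun q => prime q ==> (q \in [seq c.1.1 | c <- sieve2_lo])) (iota 0 74).
  by vm_compute.
have : p \in [seq c.1.1 | c <- sieve2_lo].
  by apply: (implyP (allP small p _)) p_pr; rewrite mem_iota.
case/mapP => -[[q ex] L] c_in /= def_p.
have ok : all (fun c => (0 < c.2)%N && all (fun v => sieve_exp c.1.2 c.2 v ==> (H v <= 1)%N) (iota 0 c.2)) sieve2_lo.
  by vm_compute.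
have /andP[L_gt0 /allP okc] := allP ok _ c_in.
have := allP hs _ c_in; rewrite /= -def_p => hv.
apply: (implyP (okc _ _) hv); rewrite mem_iota add0n /=.
by case/andP: hv; rewrite eqn0Ngt L_gt0.
Qed.

Lemma H_sieve2_hi n : (H n <= 2)%N -> sieve sieve2_hi n.
Proof.
move/H_leSP => h; apply/allP => -[[p ex] L] c_in /=.
have ok : all (fun c => [&& prime c.1.1, c.2 == 0 & all (fun a => 1 < H a) c.1.2])%N sieve2_hi.
  by vm_compute.
have /and3P[/= p_pr /eqP -> /allP okc] := allP ok _ c_in.
rewrite /sieve_exp /=; apply/negP => /okc.
by rewrite ltnNge h.
Qed.

Local Open Scope Z_scope.

(** The mass p^-a - p^-(a+1) of an excluded exponent is (p - 1) / p^(a+1), with q = p^(a+1). *)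
Fixpoint factor_frac (p : Z) (ex : seq nat) (L : nat) : Z * Z :=
  if ex is a :: ex' then
    let: (u, v) := factor_frac p ex' L in
    let q := Z.pow p (Z.of_nat a.+1) in
    (Z.sub (Z.mul u q) (Z.mul v (Z.sub p 1)), Z.mul v q)
  else if L == 0%N then (1, 1)
  else let q := Z.pow p (Z.of_nat L) in (Z.sub q 1, q).

Fixpoint sieve_frac (l : seq (nat * seq nat * nat)) : Z * Z :=
  if l is c :: l' then
    let: (u, v) := sieve_frac l' in
    let: (s, t) := factor_frac (Z.of_nat c.1.1) c.1.2 c.2 in
    (Z.mul u s, Z.mul v t)
  else (1, 1).

Local Open Scope R_scope.

Lemma factor_fracE p ex L : (0 < p)%N ->
  let f := factor_frac (Z.of_nat p) ex L in
  0 < IZR f.2 /\ sieve_factor p ex L = IZR f.1 / IZR f.2.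
Proof.
move=> p_gt0; have p_pos : 0 < INR p by apply/lt_0_INR/ltP.
have powE k : IZR (Z.pow (Z.of_nat p) (Z.of_nat k)) = INR p ^ k by rewrite INR_IZR_INZ pow_IZR.
elim: ex => [|a ex IH].
  rewrite /=; case: eqP => [_|_] /=; first by split; lra.
  have := pow_lt _ L p_pos; rewrite minus_IZR powE; move: (INR p ^ L) => x x_pos.
  by split => //; field; lra.
have -> : factor_frac (Z.of_nat p) (a :: ex) L =
   let: (u, v) := factor_frac (Z.of_nat p) ex L in
    let q := Z.pow (Z.of_nat p) (Z.of_nat a.+1) in
    (Z.sub (Z.mul u q) (Z.mul v (Z.sub (Z.of_nat p) 1)), Z.mul v q) by [].
have -> : sieve_factor p (a :: ex) L =
  sieve_factor p ex L - (/ INR p ^ a - / INR p ^ a.+1) by [].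
case: (factor_frac _ _ _) IH => u v; cbn [fst snd]; move=> [v_pos ->].
rewrite minus_IZR !mult_IZR minus_IZR -INR_IZR_INZ powE -tech_pow_Rmult.
have := pow_lt _ a p_pos; move: (INR p ^ a) => x x_pos.
split; first by repeat apply: Rmult_lt_0_compat.
field; lra.
Qed.

Lemma sieve_fracE l : all (fun c => 0 < c.1.1)%N l ->
  0 < IZR (sieve_frac l).2 /\ sieve_density l = IZR (sieve_frac l).1 / IZR (sieve_frac l).2.
Proof.
elim: l => [|[[p ex] L] l IH]; first by move=> _ /=; split; lra.
case/andP; rewrite [(_, _).1.1]/= => p_gt0 /IH {}IH.
have := @factor_fracE p ex L p_gt0.
have -> : sieve_frac ((p, ex, L) :: l) = let: (u, v) := sieve_frac l in
    let: (s, t) := factor_frac (Z.of_nat p) ex L in (Z.mul u s, Z.mul v t) by [].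
have -> : sieve_density ((p, ex, L) :: l) = sieve_density l * sieve_factor p ex L by [].
case: (sieve_frac l) IH => u v; case: (factor_frac _ _ _) => s t; cbn [fst snd].
move=> [v_pos ->] [t_pos ->]; rewrite !mult_IZR.
by split; [apply: Rmult_lt_0_compat | field; lra].
Qed.

Lemma frac_le (a b c d : Z) : 0 < IZR b -> 0 < IZR d ->
  Z.leb (Z.mul a d) (Z.mul c b) -> IZR a / IZR b <= IZR c / IZR d.
Proof.
move=> b_pos d_pos /Z.leb_le /IZR_le; rewrite !mult_IZR => h.
apply/Rcomplements.Rle_div_l => //.
have -> : IZR c / IZR d * IZR b = IZR c * IZR b / IZR d by field; lra.
exact/Rcomplements.Rle_div_r.
Qed.

Lemma Hdens2_bounds : 955922 / 1000000 <= Hdens 2 <= 955953 / 1000000.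
Proof.
split.
  have lo : 95592302 / 100000000 <= sieve_density sieve2_lo.
    have [den_pos ->] := @sieve_fracE sieve2_lo isT.
    by apply: frac_le => //; lra.
  have wf : sieve_wf sieve2_lo by vm_compute.
  have := density_le_count _ (density_sieve wf) (@density_H_le 2)
    (@count_le_large_pow 73 3 isT isT).
  have -> : / (INR 3 * INR 73 ^ 3) = / 1167051 by rewrite !INR_IZR_INZ /=; congr Rinv; lra.
  suff h : forall n, (0 < n)%N -> b2R (sieve sieve2_lo n) <= b2R (H n <= 2)%N + b2R (large_pow 74 4 n).
    by move/(_ h); lra.
  move=> n n_gt0; have := b2R_bounds (H n <= 2)%N; have := b2R_bounds (large_pow 74 4 n).
  case hs: (sieve _ n); case hl: (large_pow _ _ n); cbn [b2R]; try lra.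
  by rewrite (sieve2_lo_H n_gt0 hs) ?hl //; cbn [b2R]; lra.
have wf : sieve_wf sieve2_hi by vm_compute.
apply: Rle_trans (density_le _ (@density_H_le 2) (density_sieve wf)) _.
  by move=> n _; apply: H_sieve2_hi.
have [den_pos ->] := @sieve_fracE sieve2_hi isT.
by apply: frac_le => //; lra.
Qed.

(** * The value of c_1 *)

Lemma pow_le_anti x m n : 0 <= x <= 1 -> (m <= n)%N -> x ^ n <= x ^ m.
Proof.
move=> x01 mn; rewrite -(subnKC mn) -plusE pow_add -[X in _ <= X]Rmult_1_r.
apply: Rmult_le_compat_l; first by apply: pow_le; lra.
by rewrite -(pow1 (n - m)); apply: pow_incr.
Qed.

Lemma Hdens0 : Hdens 0 = 0.
Proof.
apply: Rle_antisym.
  apply: (density_count_le (@density_H_le 0)); exists 1 => N.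
  rewrite Rmult_0_l Rplus_0_l count_uptoE; apply: sum_indicator_le; first lra.
  move=> n n_gt0 hn; rewrite -[1]/(INR 1); apply: leq_INR.
  by rewrite leqNgt; apply/negP => n_gt1; rewrite HE in hn.
apply: (density_count_ge (@density_H_le 0)); exists 0 => N.
by rewrite Rmult_0_l Rminus_0_r; apply: pos_INR.
Qed.

Lemma sum_f_R0_bigop a n : sum_f_R0 a n = \sum_(0 <= k < n.+1) a k.
Proof. by elim: n => [|n IHn]; rewrite ?big_nat1 // Rsum_recr //= IHn. Qed.

Lemma c_1_split M : (0 < M)%N ->
  c_1 = \sum_(0 <= k < M) c1_term k + Series (fun k => c1_term (M + k)).
Proof.
move=> M_gt0; rewrite /c_1 (Series_incr_n _ M) //; [|exact/ltP|exact: ex_series_c1].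
by rewrite sum_f_R0_bigop; case: M M_gt0.
Qed.

(** The first three terms add up to 29/2 - 2 Q_1 - 12 Q_2 - 16 [Htail 3]; the fourth, about 0.001,
    is estimated with m = 16, and the rest is negligible. *)
Lemma c_1_bounds : 1813 / 1000 <= c_1 < 1814 / 1000.
Proof.
have t3 : tet 2 3 = 16%N by [].
(* 2^^4 is 65536; the crude 60 avoids computing with that exponent and already gives a tail below
   10^-7. *)
have t4 : (60 <= tet 2 4)%N.
  by rewrite tetS t3; apply: (@leq_trans (2 ^ 6)) => //; rewrite leq_exp2l.
have tail : Rabs (Series (fun k => c1_term (4 + k))) <= / 10000000.
  have [] := @c1_tail 7 4.
  - lra.
  - by move=> j j_ge; apply: c1_term_abs_le; apply: leq_trans j_ge.
  move=> _ h; apply: Rle_trans h _.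
  have : (2 / 3) ^ tet 2 4 <= (2 / 3) ^ 60 by apply: pow_le_anti; [lra | exact: t4].
  have : (2 / 3) ^ 60 <= / 10000000000 by lra.
  lra.
rewrite (@c_1_split 4) //; move: tail; move: (Series _) => T /Rabs_le_between hT.
rewrite /index_iota /= !big_cons big_nil Rplus_0_r.
have := @c1_term_le_sharp 3 isT; have := @c1_term_ge_sharp 3 isT.
have := pow2_tail_small (tet 2 3).
have := @Htail_le_sharp 3 isT; have := @Htail_ge 3 isT.
have : c1_term 2 = 16 * (Htail 2 - Htail 3) - / 2.
  by rewrite c1_termE (_ : tet 2 2 = 4%N) //; congr (_ * _ - _); ring.
have : c1_term 1 = 4 * (Htail 1 - Htail 2) - / 2.
  by rewrite c1_termE (_ : tet 2 1 = 2%N) //; congr (_ * _ - _); ring.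
have : c1_term 0 = 2 * (1 - Htail 1) - / 2.
  rewrite c1_termE (_ : tet 2 0 = 1%N) // {1}/Htail Hdens0; ring.
have := Hdens1_bounds; have := Hdens2_bounds.
have -> : Htail 1 = 1 - Hdens 1 by [].
have -> : Htail 2 = 1 - Hdens 2 by [].
cbv zeta; rewrite -/(tet 2 4) (tetS 3) t3 (_ : INR 16.-1 = 15); last by rewrite INR_IZR_INZ.
move: (Hdens 1) (Hdens 2) (Htail 3) (c1_term 0) (c1_term 1) (c1_term 2) (c1_term 3).
move=> q1 q2 h3 x0 x1 x2 x3 hq2 hq1 e0 e1 e2 h3_ge h3_le.
(* Generalised so that 2^65536 is never evaluated; [pow2_tail_small] has supplied the bound w <=
   2^-16. *)
move: (2 ^ 16 * / 2 ^ (2 ^ 16)%N) => w w_le x3_ge x3_le.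
have p23 : (2 / 3) ^ 16 = 65536 / 43046721 by field.
have p2 : / 2 ^ 16 = / 65536 by field.
have p3 : / 3 ^ 16 = / 43046721 by field.
rewrite ?p23 ?p2 ?p3 in h3_ge h3_le x3_ge x3_le w_le.
by split; lra.
Qed.

(** * The asymptotic formula *)

Lemma nfloor_bounds x : 0 <= x -> INR (Defs.nfloor x) <= x < INR (Defs.nfloor x) + 1.
Proof.
move=> x_ge0; have [h1 h2] := base_Int_part x.
have z_ge0 : (0 <= Int_part x)%Z.
  by apply/Z.lt_pred_le/lt_IZR => /=; lra.
by rewrite /Defs.nfloor INR_IZR_INZ Znat.Z2Nat.id //; lra.
Qed.

Lemma nfloor_INR n : Defs.nfloor (INR n) = n.
Proof.
have [h1 h2] := nfloor_bounds (pos_INR n); rewrite -S_INR in h2.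
apply/eqP; rewrite eqn_leq; apply/andP; split; first exact/leP/INR_le.
by rewrite -ltnS; apply/ltP/INR_lt.
Qed.

Lemma nfloor_ge n x : INR n <= x -> (n <= Defs.nfloor x)%N.
Proof.
move=> nx; have [_ h] := nfloor_bounds (Rle_trans _ _ _ (pos_INR n) nx).
by rewrite -ltnS; apply/ltP/INR_lt; rewrite S_INR; lra.
Qed.

Lemma logstarP x : 2 <= x -> exists m,
  [/\ logstar x = m.+1, 2 ^ tet 2 m <= x, x < 2 ^ tet 2 m.+1
    & (Defs.nfloor x < tet 2 m.+2)%N].
Proof.
move=> x_ge2; have N_ge2 := @nfloor_ge 2 x x_ge2.
have x_ge0 : 0 <= x by lra.
have [l_gt0 l1 l2] := logstar_natP N_ge2.
have [h1 h2] := nfloor_bounds x_ge0.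
exists (logstar x).-1; rewrite prednK //; split => //.
- apply: Rle_trans h1; rewrite -[2]/(INR 2) -INR_expn -tetS prednK //.
  exact: leq_INR.
rewrite -[2]/(INR 2) -INR_expn -tetS; apply: Rlt_le_trans h2 _.
by rewrite -S_INR; apply: leq_INR.
Qed.

Lemma Htail_le1 j : Htail j <= 1.
Proof.
apply: (density_count_le (@density_H_gt j)); exists 0 => N.
by rewrite Rmult_1_l Rplus_0_r; apply/leq_INR/count_upto_le.
Qed.

(** 19 = 18 + 1: the fractional part of x costs at most 1 <= sqrt x. *)
Lemma Dcount_bound k x : 1 <= x ->
  Rabs (Dcount k.+1 x - x * Dens k.+1) <= 19 * sqrt x.
Proof.
move=> x_ge1; have x_ge0 : 0 <= x by lra.
have [h1 h2] := nfloor_bounds x_ge0; rewrite /Dcount; set N := Defs.nfloor x in h1 h2 *.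
have -> : INR (DcountN k.+1 N) - x * Dens k.+1 =
  (INR (DcountN k.+1 N) - Dens k.+1 * INR N) + - (Dens k.+1 * (x - INR N)) by ring.
apply: Rle_trans (Rabs_triang _ _) _; rewrite Rabs_Ropp Rabs_mult.
have := DcountN_bound k N.
have : sqrt (INR N) <= sqrt x by apply: sqrt_le_1_alt.
have : 1 <= sqrt x by rewrite -sqrt_1; apply: sqrt_le_1_alt.
have : Rabs (Dens k.+1) * Rabs (x - INR N) <= 1 * 1.
  apply: Rmult_le_compat; try exact: Rabs_pos.
    rewrite DensE; have := Htail_ge0 k; have := Htail_ge0 k.+1.
    by have := Htail_le1 k; have := Htail_le1 k.+1 => ? ? ? ?; apply: Rabs_le; lra.
  by apply: Rabs_le; lra.
lra.
Qed.

(** ln x may be below 1 but is at least ln 2, so (ln x)^(9/4) >= (ln 2)^(5/4) ln x. The constant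
    adds what each of the two inequalities requires. *)
Lemma errE_dominates : exists2 c, 0 < c & forall x, 2 <= x ->
  sqrt x <= c * errE x /\ sqrt x * ln x <= c * errE x.
Proof.
have l2 : 0 < ln 2 by rewrite -ln_1; apply: ln_increasing; lra.
pose k := Rpower (ln 2) (5 / 4); have k_gt0 : 0 < k by apply: exp_pos.
have ik := Rinv_0_lt_compat _ k_gt0; have il := Rinv_0_lt_compat _ l2.
exists (/ k * (1 + / ln 2)); first by apply: Rmult_lt_0_compat; lra.
move=> x x_ge2; have lx : ln 2 <= ln x by apply: ln_le; lra.
have s_gt0 : 0 < sqrt x by apply: sqrt_lt_R0; lra.
have big : k * (sqrt x * ln x) <= errE x.
  rewrite /errE (_ : 1 / 2 = / 2); last lra.
  rewrite Rpower_sqrt; last lra.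
  have -> : 9 / 4 = 1 + 5 / 4 by lra.
  rewrite Rpower_plus Rpower_1; last lra.
  have : k <= Rpower (ln x) (5 / 4) by apply: Rle_Rpower_l; lra.
  move=> h; rewrite -Rmult_assoc Rmult_comm -Rmult_assoc (Rmult_comm _ k) -Rmult_assoc.
  have sl : 0 <= sqrt x * ln x by apply: Rmult_le_pos; lra.
  have := Rmult_le_compat_l _ _ _ sl h; lra.
have e_ge : sqrt x * ln x <= / k * errE x.
  apply: (Rmult_le_reg_l k) => //; rewrite -(Rmult_assoc k (/ k)) Rinv_r; lra.
have s_le : sqrt x <= / ln 2 * (sqrt x * ln x).
  have -> : / ln 2 * (sqrt x * ln x) = sqrt x * (ln x * / ln 2) by ring.
  rewrite -[X in X <= _]Rmult_1_r; apply: Rmult_le_compat_l; first lra.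
  by apply/Rcomplements.Rle_div_r => //; lra.
have sl : 0 <= sqrt x * ln x by apply: Rmult_le_pos; lra.
have := Rmult_le_compat_l (/ ln 2) _ _ (Rlt_le _ _ il) e_ge.
have e_ge0 : 0 <= / k * errE x by lra.
have := Rmult_le_pos _ _ (Rlt_le _ _ il) e_ge0.
split; lra.
Qed.

Lemma tet_le_ln m x : 2 ^ tet 2 m <= x -> INR (tet 2 m) * ln 2 <= ln x.
Proof.
move=> h; rewrite -ln_pow; last lra.
by apply: ln_le => //; apply: pow_lt; lra.
Qed.

Lemma sum_tet m : \sum_(0 <= k < m) INR (tet 2 k.+1) <= 2 * INR (tet 2 m).
Proof.
elim: m => [|m IHm]; first by rewrite big_geq //=; lra.
rewrite Rsum_recr //; apply: (@Rle_trans _ (2 * INR (tet 2 m) + INR (tet 2 m.+1))); first lra.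
by have := leq_INR (tet_double m); rewrite mult_INR -[INR 2]/2; lra.
Qed.

(** After squaring, (4/9)^t <= 2^-t < 1 / x. *)
Lemma tail_pow_le_sqrt x t : 0 < x -> x < 2 ^ t -> x * (2 / 3) ^ t <= sqrt x.
Proof.
move=> x_gt0 x_lt; have s_gt0 := sqrt_lt_R0 _ x_gt0.
have s2 := sqrt_sqrt _ (Rlt_le _ _ x_gt0).
have q_gt0 : 0 < (2 / 3) ^ t by apply: pow_lt; lra.
suff h : sqrt x * (2 / 3) ^ t <= 1.
  by have := Rmult_le_compat_l _ _ _ (Rlt_le _ _ s_gt0) h; rewrite -Rmult_assoc s2; lra.
have q2 : (2 / 3) ^ t * (2 / 3) ^ t <= / 2 ^ t.
  by rewrite -Rpow_mult_distr -pow_inv; apply: pow_incr; lra.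
have : x * ((2 / 3) ^ t * (2 / 3) ^ t) <= 1.
  apply: Rle_trans (Rmult_le_compat_l _ _ _ (Rlt_le _ _ x_gt0) q2) _.
  by apply/Rcomplements.Rle_div_l; [apply: pow_lt; lra | lra].
rewrite -{1}s2; move: (sqrt x) ((2 / 3) ^ t) s_gt0 q_gt0 => s q s_gt0 q_gt0 h.
have sq : 0 < s * q by apply: Rmult_lt_0_compat.
apply: Rnot_lt_le => h2.
have : 1 * 1 < (s * q) * (s * q) by apply: Rmult_gt_0_lt_compat; lra.
lra.
Qed.

Lemma H_lt_tet n m : (n < tet 2 m.+1)%N -> (H n <= m)%N.
Proof.
case: n => // n h; rewrite leqNgt; apply/negP => h2.
by have := tet_leq_of_H (isT : 0 < n.+1)%N h2; rewrite leqNgt h.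
Qed.

Lemma calH_sum x m : (Defs.nfloor x < tet 2 m.+2)%N ->
  calH x = INR (DcountN 0 (Defs.nfloor x)) +
           \sum_(0 <= k < m.+1) INR (tet 2 k.+1) * Dcount k.+1 x.
Proof.
move=> h; rewrite /calH /Dcount; set N := Defs.nfloor x in h *.
have -> : foldr Rplus 0 [seq INR (tet 2 (H n)) | n <- iota 1 N] =
    \sum_(1 <= n < N.+1) INR (tet 2 (H n)).
  rewrite /index_iota subSS subn0; elim: (iota 1 N) => [|n s IHs]; rewrite ?big_nil // big_cons -IHs //.
transitivity (\sum_(1 <= n < N.+1) \sum_(0 <= k < m.+2) INR (tet 2 k) * b2R (H n == k)).
  rewrite big_nat [RHS]big_nat; apply: eq_bigr => n /andP[n_gt0 nN].
  have Hn : (H n < m.+2)%N by rewrite ltnS; apply: H_lt_tet; apply: leq_ltn_trans h; rewrite -ltnS.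
  rewrite (bigD1_seq (H n)) ?iota_uniq ?mem_index_iota //= eqxx /= big1.
    by rewrite Rmult_1_r Rplus_0_r.
  by move=> k; rewrite eq_sym => /negPf -> /=; rewrite Rmult_0_r.
rewrite exchange_big big_nat_recl //=; congr Rplus.
  rewrite -[DcountN 0 N]/(count_upto (fun n => H n == 0)%N N) count_uptoE.
  by apply: eq_bigr => n _; rewrite Rmult_1_l.
apply: eq_bigr => k _; rewrite Rsum_mulr.
by rewrite -[DcountN k.+1 N]/(count_upto (fun n => H n == k.+1)%N N) count_uptoE.
Qed.

Lemma DcountN0_le1 N : INR (DcountN 0 N) <= 1.
Proof.
rewrite -[DcountN 0 N]/(count_upto (fun n => H n == 0)%N N) count_uptoE.
apply: sum_indicator_le; first lra.
move=> n n_gt0 /eqP hn; rewrite -[1]/(INR 1); apply: leq_INR.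
by rewrite leqNgt; apply/negP => n_gt1; rewrite HE in hn.
Qed.

Lemma logstar_tet m : logstar (INR (tet 2 m.+1)) = m.+1.
Proof.
rewrite /logstar nfloor_INR; apply: logstar_nat_uniq.
  exact: (@tet_leq 1 m.+1).
by rewrite leqnn tet_ltS.
Qed.

Lemma logstar_tet_pred m : logstar (INR (tet 2 m.+2) - 1) = m.+1.
Proof.
have g : (0 < tet 2 m.+2)%N by apply: tet_gt0.
have -> : INR (tet 2 m.+2) - 1 = INR (tet 2 m.+2).-1.
  by rewrite -{1}(prednK g) S_INR; ring.
have lt := tet_ltS m.+1; rewrite /logstar nfloor_INR; apply: logstar_nat_uniq.
  rewrite -ltnS prednK //; apply: leq_ltn_trans lt; exact: (@tet_leq 1 m.+1).
by rewrite -ltnS prednK // lt leqnn.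
Qed.

(** 2^^(m+1) has height m + 1 and every smaller integer has lower height, so it is the only one
    counted. *)
Lemma Dcount_tet m : Dcount m.+1 (INR (tet 2 m.+1)) = 1.
Proof.
rewrite /Dcount nfloor_INR -[DcountN _ _]/(count_upto (fun n => H n == m.+1)%N _).
have e := prednK (tet_gt0 m.+1); rewrite -e count_uptoS e H_tet eqxx.
suff -> : count_upto (fun n => H n == m.+1)%N (tet 2 m.+1).-1 = 0%N by [].
apply/eqP; rewrite -leqn0 leqNgt -has_count; apply/hasPn => n.
rewrite mem_iota add1n e => /andP[_ nt]; apply/negP => /eqP Hn.
by have := H_lt_tet nt; rewrite Hn ltnn.
Qed.

Lemma Rpower_Delta t : Rpower (2 ^ t) Delta_exp = 2 ^ t * (2 / 3) ^ t.
Proof.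
have l2 : 0 < ln 2 by rewrite -ln_1; apply: ln_increasing; lra.
rewrite /Rpower ln_pow; last lra.
rewrite -Rpow_mult_distr -(exp_ln ((2 * (2 / 3)) ^ t)); last by apply: pow_lt; lra.
rewrite ln_pow; last lra.
have -> : 2 * (2 / 3) = 2 * 2 * / 3 by lra.
rewrite !ln_mult ?ln_Rinv; try lra.
by congr exp; rewrite /Delta_exp; field; lra.
Qed.

Lemma c1_term_Dens m : INR (tet 2 m.+1) * Dens m.+1 = c1_term m + / 2.
Proof. by rewrite /c1_term; lra. Qed.

(** Each weighted count is the weight times the counting error E k, plus x ([c1_term k] + 1/2). The
    halves sum to x log* x / 2, the terms to x (c_1 - T), and the last error, k = m, is H_1. There
    remain the contribution of n = 1, the errors with k < m, whose weights sum to at most 2 ln x /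
    ln 2 (hence 38 = 2 19), and x T. *)
Lemma calH_asymptotic : exists C : R, forall x : R, 2 <= x ->
  Rabs (calH x - (x * INR (logstar x) / 2 + c_1 * x + H1 x)) <= C * errE x.
Proof.
have [K K_gt0 hK] := c1_term_bounded; have [c c_gt0 hc] := errE_dominates.
have l2 : 0 < ln 2 by rewrite -ln_1; apply: ln_increasing; lra.
exists ((1 + 3 * K) * c + 38 / ln 2 * c) => x x_ge2.
have [m [lx m_lo m_hi N_hi]] := logstarP x_ge2; have [e1 e2] := hc x x_ge2.
pose E k := Dcount k.+1 x - x * Dens k.+1.
have E_le k : Rabs (E k) <= 19 * sqrt x by apply: Dcount_bound; lra.
pose T := Series (fun k => c1_term (m.+1 + k)).
have T_le : Rabs (x * T) <= 3 * K * sqrt x.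
  have [_ hT] := @c1_tail K m.+1 (Rlt_le _ _ K_gt0) (fun j _ => hK j).
  rewrite Rabs_mult (Rabs_pos_eq x); last lra.
  have x_ge0 : 0 <= x by lra.
  have := Rmult_le_compat_l _ _ _ x_ge0 hT.
  have x_gt0 : 0 < x by lra.
  by have := Rmult_le_compat_l _ _ _ (Rlt_le _ _ K_gt0) (tail_pow_le_sqrt x_gt0 m_hi); rewrite -/T; lra.
have S_le : Rabs (\sum_(0 <= k < m) INR (tet 2 k.+1) * E k) <= 38 / ln 2 * (sqrt x * ln x).
  apply: Rle_trans (Rsum_abs _ _ _) _.
  apply: (@Rle_trans _ (\sum_(0 <= k < m) 19 * sqrt x * INR (tet 2 k.+1))).
    apply: Rsum_nat_le => k _; rewrite Rabs_mult (Rabs_pos_eq _ (pos_INR _)) Rmult_comm.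
    by apply: Rmult_le_compat_r (E_le k); apply: pos_INR.
  rewrite Rsum_mulr; have s_ge0 := sqrt_pos x.
  apply: (@Rle_trans _ (19 * sqrt x * (2 * (ln x / ln 2)))); last by apply: Req_le; field; lra.
  apply: Rmult_le_compat_l; first lra.
  apply: Rle_trans (sum_tet m) _; apply: Rmult_le_compat_l; first lra.
  by apply/Rcomplements.Rle_div_r => //; apply: tet_le_ln.
have -> : calH x - (x * INR (logstar x) / 2 + c_1 * x + H1 x) =
    INR (DcountN 0 (Defs.nfloor x)) + \sum_(0 <= k < m) INR (tet 2 k.+1) * E k - x * T.
  rewrite (calH_sum N_hi) /H1 lx (@c_1_split m.+1) // -/T.
  have -> : \sum_(0 <= k < m.+1) INR (tet 2 k.+1) * Dcount k.+1 x =
     \sum_(0 <= k < m.+1) INR (tet 2 k.+1) * E k + x * \sum_(0 <= k < m.+1) c1_term k + x * INR m.+1 / 2.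
    rewrite -Rsum_mulr; elim: (m.+1) => [|j IHj]; first by rewrite !big_geq //=; lra.
    rewrite !Rsum_recr // IHj S_INR /E.
    have := c1_term_Dens j; nra.
  rewrite (Rsum_recr (fun k => INR (tet 2 k.+1) * E k)) // /E; ring.
have := DcountN0_le1 (Defs.nfloor x); have := pos_INR (DcountN 0 (Defs.nfloor x)).
have s1 : 1 <= sqrt x by rewrite -sqrt_1; apply: sqrt_le_1_alt; lra.
move: (INR (DcountN _ _)) => a a_ge0 a_le1.
apply: (@Rle_trans _ ((1 + 3 * K) * sqrt x + 38 / ln 2 * (sqrt x * ln x))).
  move/Rabs_le_between: T_le => T_le; move/Rabs_le_between: S_le => S_le.
  by apply: Rabs_le; lra.
have i2 : 0 <= 38 / ln 2 by apply: Rcomplements.Rdiv_le_0_compat; lra.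
have k1 : 0 <= 1 + 3 * K by lra.
have := Rmult_le_compat_l _ _ _ k1 e1; have := Rmult_le_compat_l _ _ _ i2 e2; lra.
Qed.

(** Here the saving sqrt x would be lost against a weight as large as x. Instead the two halves are
    bounded separately: the weight 2^(2^^m) cancels the density bound of [count_H_gt], and the
    expected value is x (1/2 + [c1_term m]). *)
Lemma H1_linear : exists C : R, forall x : R, 2 <= x -> Rabs (H1 x) <= C * x.
Proof.
have [K K_gt0 hK] := c1_term_bounded.
exists (4 + K) => x x_ge2; have [m [lx m_lo m_hi N_hi]] := logstarP x_ge2.
have x_ge0 : 0 <= x by lra.
have [N_le _] := nfloor_bounds x_ge0.
have -> : H1 x = INR (tet 2 m.+1) * Dcount m.+1 x - x * (c1_term m + / 2).
  by rewrite /H1 lx -c1_term_Dens; ring.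
have q_ge0 : 0 <= (2 / 3) ^ tet 2 m by apply: pow_le; lra.
have q_le1 : (2 / 3) ^ tet 2 m <= 1 by rewrite -(pow1 (tet 2 m)); apply: pow_incr; lra.
have cK : Rabs (c1_term m) <= K.
  by apply: Rle_trans (hK m) _; rewrite -[X in _ <= X]Rmult_1_r; apply: Rmult_le_compat_l; lra.
have D_ge0 : 0 <= INR (tet 2 m.+1) * Dcount m.+1 x by apply: Rmult_le_pos; apply: pos_INR.
have D_le : INR (tet 2 m.+1) * Dcount m.+1 x <= 3 * x.
  case: (posnP m) => [->|m_gt0].
    have : Dcount 1 x <= INR (Defs.nfloor x) by apply/leq_INR/count_upto_le.
    by rewrite [INR (tet 2 1)]/=; lra.
  have : Dcount m.+1 x <= 3 * / 2 ^ tet 2 m * INR (Defs.nfloor x).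
    apply: Rle_trans (count_H_gt _ m_gt0); apply/leq_INR/sub_count => n /eqP ->.
    exact: ltnSn.
  have t_gt0 : 0 < 2 ^ tet 2 m by apply: pow_lt; lra.
  move/(Rmult_le_compat_l _ _ _ (Rlt_le _ _ t_gt0)).
  rewrite tetS INR_expn -[INR 2]/2.
  have -> : 2 ^ tet 2 m * (3 * / 2 ^ tet 2 m * INR (Defs.nfloor x)) = 3 * INR (Defs.nfloor x) by field; lra.
  lra.
move/Rabs_le_between: cK => cK; apply: Rabs_le; nra.
Qed.

(** Just below 2^^N the weight is only 2^^(N-1) = log_2 (x + 1), so [Dcount_bound] suffices. *)
Lemma H1_before_tet : exists C : R, forall N : nat, 2 <= INR (tet 2 N) - 1 ->
  Rabs (H1 (INR (tet 2 N) - 1)) <= C * errE (INR (tet 2 N) - 1).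
Proof.
have [c c_gt0 hc] := errE_dominates.
have l2 : 0 < ln 2 by rewrite -ln_1; apply: ln_increasing; lra.
exists (38 / ln 2 * c) => -[|[|m]]; rewrite ?[INR (tet 2 0)]/= ?[INR (tet 2 1)]/=; try lra.
move=> x_ge2; have [_ e2] := hc _ x_ge2.
have x1 : INR (tet 2 m.+2) - 1 + 1 = 2 ^ tet 2 m.+1.
  by rewrite tetS INR_expn -[INR 2]/2; ring.
rewrite /H1 logstar_tet_pred.
move: (INR (tet 2 m.+2) - 1) x_ge2 e2 x1 => x x_ge2 e2 x1.
have t_le : INR (tet 2 m.+1) <= 2 * ln x / ln 2.
  apply/Rcomplements.Rle_div_r => //; apply: Rle_trans (tet_le_ln (Req_le _ _ (esym x1))) _.
  (* x + 1 <= x^2 for x >= 2 replaces ln (x + 1) by 2 ln x. *)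
  have -> : 2 * ln x = ln (x * x) by rewrite ln_mult; lra.
  by apply: ln_le; nra.
rewrite Rabs_mult (Rabs_pos_eq _ (pos_INR _)).
have x_ge1 : 1 <= x by lra.
apply: Rle_trans (Rmult_le_compat _ _ _ _ (pos_INR _) (Rabs_pos _) t_le (Dcount_bound m x_ge1)) _.
have -> : 2 * ln x / ln 2 * (19 * sqrt x) = 38 / ln 2 * (sqrt x * ln x) by field; lra.
rewrite Rmult_assoc; apply: Rmult_le_compat_l => //.
by apply: Rcomplements.Rdiv_le_0_compat; lra.
Qed.

(** The count is 1 and the weight is x itself, so H_1(x) = x (1 - x D), where x D = 1/2 +
    [c1_term m]: the deviation from x/2 is exactly -x [c1_term m]. *)
Lemma H1_at_tet : exists C : R, forall N : nat, 2 <= INR (tet 2 N) ->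
  Rabs (H1 (INR (tet 2 N)) - INR (tet 2 N) / 2) <= C * Rpower (INR (tet 2 N)) Delta_exp.
Proof.
have [K K_gt0 hK] := c1_term_bounded.
exists K => -[|m] x_ge2; first by move: x_ge2; rewrite /=; lra.
rewrite /H1 logstar_tet Dcount_tet.
have -> : INR (tet 2 m.+1) * (1 - INR (tet 2 m.+1) * Dens m.+1) - INR (tet 2 m.+1) / 2 =
   INR (tet 2 m.+1) * - c1_term m by rewrite c1_term_Dens; field.
rewrite Rabs_mult (Rabs_pos_eq _ (pos_INR _)) Rabs_Ropp tetS INR_expn -[INR 2]/2 Rpower_Delta.
have t_gt0 : 0 < 2 ^ tet 2 m by apply: pow_lt; lra.
have := Rmult_le_compat_l _ _ _ (Rlt_le _ _ t_gt0) (hK m); lra.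
Qed.

Theorem theorem2 :
  (* c_1 is a convergent series with value 1.813... *)
  ex_series c1_term /\ 1813/1000 <= c_1 < 1814/1000 /\
  (* main asymptotic formula *)
  (exists C : R, forall x : R, 2 <= x ->
     Rabs (calH x - (x * INR (logstar x) / 2 + c_1 * x + H1 x)) <= C * errE x) /\
  (* (i) *)
  (exists C : R, forall x : R, 2 <= x -> Rabs (H1 x) <= C * x) /\
  (* (ii) *)
  (exists C : R, forall N : nat, 2 <= INR (tet 2 N) - 1 ->
     Rabs (H1 (INR (tet 2 N) - 1)) <= C * errE (INR (tet 2 N) - 1)) /\
  (* (iii) *)
  (exists C : R, forall N : nat, 2 <= INR (tet 2 N) ->
     Rabs (H1 (INR (tet 2 N)) - INR (tet 2 N) / 2) <= C * Rpower (INR (tet 2 N)) Delta_exp).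
Proof.
split; first exact: ex_series_c1.
split; first exact: c_1_bounds.
split; first exact: calH_asymptotic.
split; first exact: H1_linear.
split; first exact: H1_before_tet.
exact: H1_at_tet.
Qed.
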